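(* The property of being $\mathbf{D}$-Kähler is not stable under small deformations of the $\mathbf{D}$-complex structure. That is, there exist a compact manifold $X$ and a smooth curve $\{K_t\}_{t\in I}$ of $\mathbf{D}$-complex structures on $X$, with $I\subseteq\mathbb{R}$ an open interval containing $0$, such that $(X,K_0)$ admits a $\mathbf{D}$-Kähler structure, but it is not the case that $(X,K_t)$ admits a $\mathbf{D}$-Kähler structure for all $t$ sufficiently close to $0$.
   Context: An almost $\mathbf{D}$-complex structure on a $2n$-dimensional manifold $X$ is $K\in\mathrm{End}(TX)$ with $K^2=\mathrm{id}_{TX}$ whose eigenbundles $T^+X$, $T^-X$ for the eigenvalues $+1,-1$ both have rank $n$. It is integrable (then called $\mathbf{D}$-complex) if $[T^+X,T^+X]\subseteq T^+X$ and $[T^-X,T^-X]\subseteq T^-X$. A $\mathbf{D}$-Kähler structure on a $\mathbf{D}$-complex manifold $(X,K)$ is a $K$-compatible symplectic form, i.e. a symplectic form $\omega$ on $X$ that is $K$-anti-invariant: $\omega(K\cdot,K\cdot)=-\omega(\cdot,\cdot)$. A property is stable under small deformations if, for every compact $X$ and every smooth curve $\{K_t\}$ of $\mathbf{D}$-complex structures on $X$ such that $K_0$ has the property, $K_t$ has the property for all $t$ sufficiently close to $0$. *)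

(* Defs.v *)
From HB Require Import structures.
From mathcomp Require Import all_boot all_order all_algebra.
From mathcomp Require Import all_classical all_reals all_analysis.

Set Implicit Arguments.
Unset Strict Implicit.
Unset Printing Implicit Defensive.

Import Order.TTheory GRing.Theory Num.Theory.
Import numFieldNormedType.Exports.

Local Open Scope classical_set_scope.
Local Open Scope ring_scope.

(* Meant for U open. In finite dimension, asking for all directional
   derivatives instead of the partial ones makes no difference. *)
Fixpoint Ck_on (R : realType) (V W : normedModType R) (k : nat)
    (U : set V) (f : V -> W) : Prop :=
  match k with
  | 0 => {in U, continuous f}
  | k'.+1 => {in U, continuous f} /\
      forall v : V, (forall x, U x -> derivable f x v) /\ Ck_on k' U ('D_v f)
  end.

Definition smooth_on (R : realType) (V W : normedModType R)
    (U : set V) (f : V -> W) : Prop := forall k, Ck_on k U f.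

(* [chart i] and [chart_inv i] are total functions; only their values on
   [dom i] and on its image are meaningful. *)
Record smooth_manifold (R : realType) (m : nat) := SmoothManifold {
  carrier :> topologicalType ;
  chart_ix : Type ;
  dom : chart_ix -> set carrier ;
  chart : chart_ix -> carrier -> 'rV[R]_m ;
  chart_inv : chart_ix -> 'rV[R]_m -> carrier ;
  carrier_hausdorff : hausdorff_space carrier ;
  carrier_second_countable : @second_countable carrier ;
  dom_cover : forall p : carrier, exists i, dom i p ;
  dom_open : forall i, open (dom i) ;
  chart_image_open : forall i, open (chart i @` dom i) ;
  chartK : forall i, {in dom i, cancel (chart i) (chart_inv i)} ;
  chart_continuous : forall i, {in dom i, continuous (chart i)} ;
  chart_inv_continuous : forall i,
    {in chart i @` dom i, continuous (chart_inv i)} ;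
  transition_smooth : forall i j,
    smooth_on (chart i @` (dom i `&` dom j)) (chart j \o chart_inv i)
}.

Section Tensors.
Context (R : realType) (m : nat) (M : smooth_manifold R m).

(* Tensor fields are given by their components in the charts of the atlas:
   the component in chart i is a function on M, meaningful on [dom i] only.
   Tangent vectors are row vectors, so endomorphisms act on the right. *)

Definition in_chart (W : Type) (i : chart_ix M) (f : M -> W) : 'rV[R]_m -> W :=
  f \o chart_inv i.

(* change of coordinates from chart i to chart j for tangent vectors at p *)
Definition trans_diff (i j : chart_ix M) (p : M) (u : 'rV[R]_m) : 'rV[R]_m :=
  'D_u (in_chart i (chart j)) (chart i p).

Definition smooth_comps (W : normedModType R) (U : set M)
    (f : chart_ix M -> M -> W) : Prop :=
  forall i, smooth_on (chart i @` (U `&` dom i)) (in_chart i (f i)).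

Definition vector_field_on (U : set M)
    (v : chart_ix M -> M -> 'rV[R]_m) : Prop :=
  smooth_comps U v /\
  forall i j p, U p -> dom i p -> dom j p ->
    v j p = trans_diff i j p (v i p).

Definition lie_bracket (v w : chart_ix M -> M -> 'rV[R]_m) :
    chart_ix M -> M -> 'rV[R]_m :=
  fun i p => 'D_(v i p) (in_chart i (w i)) (chart i p)
             - 'D_(w i p) (in_chart i (v i)) (chart i p).

Definition endo_field (K : chart_ix M -> M -> 'M[R]_m) : Prop :=
  smooth_comps setT K /\
  forall i j p u, dom i p -> dom j p ->
    trans_diff i j p (u *m K i p) = trans_diff i j p u *m K j p.

Definition form2 (w : 'M[R]_m) (u v : 'rV[R]_m) : R := (u *m w *m v^T) 0 0.

Definition two_form (w : chart_ix M -> M -> 'M[R]_m) : Prop :=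
  [/\ smooth_comps setT w,
      forall i p u, dom i p -> form2 (w i p) u u = 0 &
      forall i j p u v, dom i p -> dom j p ->
        form2 (w i p) u v =
        form2 (w j p) (trans_diff i j p u) (trans_diff i j p v)].

(* component of dw in chart i, evaluated on three coordinate-constant fields *)
Definition ext_diff2 (w : chart_ix M -> M -> 'M[R]_m) (i : chart_ix M) (p : M)
    (u v z : 'rV[R]_m) : R :=
  'D_u (in_chart i (fun q => form2 (w i q) v z)) (chart i p)
  - 'D_v (in_chart i (fun q => form2 (w i q) u z)) (chart i p)
  + 'D_z (in_chart i (fun q => form2 (w i q) u v)) (chart i p).

Definition symplectic (w : chart_ix M -> M -> 'M[R]_m) : Prop :=
  [/\ two_form w,
      forall i p u v z, dom i p -> ext_diff2 w i p u v z = 0 &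
      forall i p u, dom i p -> (forall v, form2 (w i p) u v = 0) -> u = 0].

Definition eigen_section (K : chart_ix M -> M -> 'M[R]_m) (a : R) (U : set M)
    (v : chart_ix M -> M -> 'rV[R]_m) : Prop :=
  vector_field_on U v /\
  forall i p, U p -> dom i p -> (v i p <= eigenspace (K i p) a)%MS.

(* [T, T] <= T for T the eigenbundle of K for a; sections are local *)
Definition involutive_eigen (K : chart_ix M -> M -> 'M[R]_m) (a : R) : Prop :=
  forall (U : set M) v w, open U ->
    eigen_section K a U v -> eigen_section K a U w ->
    forall i p, U p -> dom i p ->
      (lie_bracket v w i p <= eigenspace (K i p) a)%MS.

Definition dkahler (K : chart_ix M -> M -> 'M[R]_m) : Prop :=
  exists w, symplectic w /\
    forall i p u v, dom i p ->
      form2 (w i p) (u *m K i p) (v *m K i p) = - form2 (w i p) u v.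

Definition smooth_curve (I : set R)
    (K : R -> chart_ix M -> M -> 'M[R]_m) : Prop :=
  forall i, smooth_on (I `*` (chart i @` dom i))
    (fun tx : R * 'rV[R]_m => K tx.1 i (chart_inv i tx.2)).

End Tensors.

Definition almost_dcomplex (R : realType) (n : nat)
    (M : smooth_manifold R (2 * n)) (K : chart_ix M -> M -> 'M[R]_(2 * n)) :
    Prop :=
  endo_field K /\
  forall i p, dom i p ->
    [/\ K i p *m K i p = 1%:M,
        \rank (eigenspace (K i p) 1) = n &
        \rank (eigenspace (K i p) (-1)) = n].

Definition dcomplex (R : realType) (n : nat)
    (M : smooth_manifold R (2 * n)) (K : chart_ix M -> M -> 'M[R]_(2 * n)) :
    Prop :=
  [/\ almost_dcomplex K, involutive_eigen K 1 & involutive_eigen K (-1)].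

(* Main.v *)
Require Import Defs.
From HB Require Import structures.
From mathcomp Require Import all_boot all_order all_algebra.
From mathcomp Require Import all_classical all_reals all_analysis.
From mathcomp Require Import ring lra.

Set Implicit Arguments.
Unset Strict Implicit.
Unset Printing Implicit Defensive.

Import Order.TTheory GRing.Theory Num.Theory.
Import numFieldNormedType.Exports.
Local Open Scope classical_set_scope.
Local Open Scope ring_scope.

(** A D-Kaehler structure is a symplectic form for which both eigenfoliations are
    Lagrangian, so every leaf of the foliation for 1 carries a flat connection,
    dual to the holonomy of its normal bundle. The instability comes from a
    compact leaf whose holonomy no flat torus can realise.

    On the 4-torus let the foliation for -1 be spanned by d_2 and d_3, and the
    one for 1 by d_0 and d_1 + (t / 2) (sin(2 pi x_2) d_2 - sin(2 pi x_3) d_3).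
    Both are involutive for all t (Kfield_dcomplex), and for t = 0 both are
    Lagrangian for dx_0 dx_2 + dx_1 dx_3 (Kfield0_dkahler). The 2-torus
    x_2 = x_3 = 0 is always a leaf for 1. Its holonomy is trivial along x_0 and
    hyperbolic along x_1, with eigenvalues e^(pi t) and e^(- pi t).

    Let t be nonzero and W a D-Kaehler form. On this leaf W amounts to two
    1-forms, its contractions with d_2 and d_3. They are independent at each
    point, and closedness of W makes them closed after multiplication by
    e^(pi t y) and e^(- pi t y), where y = x_1 (not_dkahler). Since these
    multipliers differ from 1, each twisted form has a primitive with the same
    multiplier: the integral of the form over one period in y, up to a constant
    (twisted_potential). The multipliers are inverse to each other, so the
    product of the two primitives descends to the 2-torus and attains a maximum
    and a minimum there. At a critical point of the product, independence of the
    two forms forces both primitives to vanish; so the product is identically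
    zero, every point is critical, the primitives vanish, and so do the forms:
    a contradiction (no_hyperbolic_coframe). Thus no nonzero t, however small,
    gives a D-Kaehler structure. *)

(** * Calculus of smooth maps *)

Section SmoothCalculus.
Context {R : realType}.
Implicit Types V W : normedModType R.

(** The iterated derivatives of a map on an open set depend only on its values
    there, although the derivative is a total operation. *)
Lemma Ck_on_eq {V W} k (U : set V) (f g : V -> W) :
  open U -> {in U, f =1 g} -> Ck_on k U f -> Ck_on k U g.
Proof.
move=> oU; elim: k f g => [|k IH] f g fg.
  move=> /= cf x xU; rewrite /continuous_at -(fg x xU).
  apply: cvg_trans (cf x xU); apply: near_eq_cvg.
  have := open_nbhs_nbhs (conj oU (set_mem xU)).
  by apply: filterS => y Uy; rewrite fg// inE.
have near_fg x : U x -> \forall y \near x, f y = g y.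
  move=> Ux; have := open_nbhs_nbhs (conj oU Ux).
  by apply: filterS => y Uy; rewrite fg// inE.
move=> /= [cf df]; split.
  move=> x xU; rewrite /continuous_at -(fg x xU).
  by apply: cvg_trans (cf x xU); apply/near_eq_cvg/near_fg/set_mem.
move=> v; have [dv Dv] := df v; split.
  by move=> x Ux; apply: near_eq_derivable (dv x Ux); exact: near_fg.
apply: IH Dv => x /set_mem Ux.
by apply: near_eq_derive; exact: near_fg.
Qed.

Lemma Ck_onW {V W} k (U U' : set V) (f : V -> W) :
  U' `<=` U -> Ck_on k U f -> Ck_on k U' f.
Proof.
move=> UU; elim: k f => [|k IH] f /=.
  by move=> cf x /set_mem /UU xU; apply: cf; rewrite inE.
move=> [cf df]; split; first by move=> x /set_mem /UU xU; apply: cf; rewrite inE.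
by move=> v; have [dv Dv] := df v; split; [move=> x /UU; exact: dv|exact: IH].
Qed.

Lemma Ck_on_local {V W} k (U : set V) (f : V -> W) :
  (forall x, U x -> exists2 N : set V, N x & Ck_on k N f) -> Ck_on k U f.
Proof.
elim: k f => [|k IH] f loc /=.
  by move=> x /set_mem /loc[N Nx]; apply; rewrite inE.
split; first by move=> x /set_mem /loc[N Nx [+ _]]; apply; rewrite inE.
move=> v; split; first by move=> x /loc[N Nx [_ /(_ v)[+ _]]]; apply.
by apply: IH => x /loc[N Nx [_ /(_ v)[_ Dv]]]; exists N.
Qed.

Lemma smooth_cst {V W} (U : set V) (a : W) : smooth_on U (cst a).
Proof.
move=> k; elim: k a => [|k IH] a /=; first by move=> x _; exact: cst_continuous.
split; first by move=> x _; exact: cst_continuous.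
move=> v; split; first by move=> x _; exact: derivable_cst.
rewrite (_ : 'D_v _ = cst 0); first exact: IH.
by apply/funext => x; rewrite derive_cst.
Qed.

Lemma Ck_onS_continuous {V W} k (f : V -> W) :
  Ck_on k setT f -> continuous f.
Proof. by case: k => [|k] /= => [cf|[cf _]] x; apply: cf; rewrite inE. Qed.

Lemma Ck_on_le {V W} k (U : set V) (f : V -> W) : Ck_on k.+1 U f -> Ck_on k U f.
Proof.
elim: k f => [|k IH] f; first by case.
move=> [cf df]; split => // v; have [dv Dv] := df v; split => //.
exact: IH.
Qed.

Lemma CkD {V W} k (f g : V -> W) :
  Ck_on k setT f -> Ck_on k setT g -> Ck_on k setT (f \+ g).
Proof.
elim: k f g => [|k IH] f g Cf Cg.
  by move=> x _; apply: cvgD; apply: Ck_onS_continuous; eassumption.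
split; first by move=> x _; apply: cvgD; apply: Ck_onS_continuous; eassumption.
move: Cf Cg => [_ df] [_ dg] v; have [dfv Dfv] := df v; have [dgv Dgv] := dg v.
split; first by move=> x _; apply: derivableD; [exact: dfv|exact: dgv].
rewrite (_ : 'D_v _ = 'D_v f \+ 'D_v g); first exact: IH.
by apply/funext => x; rewrite deriveD//; [exact: dfv|exact: dgv].
Qed.

Lemma CkM {V} k (f g : V -> R^o) :
  Ck_on k setT f -> Ck_on k setT g -> Ck_on k setT (f \* g).
Proof.
elim: k f g => [|k IH] f g Cf Cg.
  by move=> x _; apply: cvgM; apply: Ck_onS_continuous; eassumption.
split; first by move=> x _; apply: cvgM; apply: Ck_onS_continuous; eassumption.
have [Cf' Cg'] := (Ck_on_le Cf, Ck_on_le Cg).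
move: Cf Cg => [_ df] [_ dg] v; have [dfv Dfv] := df v; have [dgv Dgv] := dg v.
split; first by move=> x _; apply: derivableM; [exact: dfv|exact: dgv].
rewrite (_ : 'D_v _ = f \* 'D_v g \+ g \* 'D_v f); first by apply: CkD; exact: IH.
by apply/funext => x; rewrite deriveM//; [exact: dfv|exact: dgv].
Qed.

(** Reduces matrix fields to scalar functions, for which products and
    trigonometric functions are at hand. *)
Lemma Ck_mx {V} k m n (M : V -> 'M[R]_(m, n)) :
  (forall i j, Ck_on k setT (fun x => M x i j : R^o)) -> Ck_on k setT M.
Proof.
have cont (N : V -> 'M[R]_(m, n)) :
    (forall i j, continuous (fun x => N x i j)) -> continuous N.
  move=> cN x; apply/cvgrPdist_lt => e e0; near=> y.
  rewrite /Num.Def.normr/= mx_normrE; apply: bigmax_lt => //= -[i j] _.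
  rewrite !mxE /=; move: i j; near: y.
  apply: filter_forall => i; apply: filter_forall => j.
  by have /cvgrPdist_lt/(_ e e0) := cN i j x.
elim: k M => [|k IH] M CM.
  by move=> x _; apply: cont => i j; apply: (@Ck_onS_continuous _ _ 0); exact: CM.
split.
  by move=> x _; apply: cont => i j; apply: (@Ck_onS_continuous _ _ k.+1); exact: CM.
have dM x v : derivable M x v.
  by apply/derivable_mxP => i j; have [_ /(_ v)[+ _]] := CM i j; apply.
move=> v; split => //; apply: IH => i j.
rewrite (_ : (fun x => _) = 'D_v (fun x => M x i j)).
  by have [_ /(_ v)[_]] := CM i j.
by apply/funext => x; rewrite derive_mx// mxE.
Unshelve. all: by end_near. Qed.

Lemma is_deriveP {V W} (f : V -> W) x v df : is_derive x v f df <->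
  h^-1 *: (f (h *: v + x) - f x) @[h --> (0:R)^'] --> df.
Proof.
split => [[dfx <-]//|cf]; split; first by apply/cvg_ex; exists df.
exact: cvg_lim cf.
Qed.

(** Transfers one-variable rules, such as the chain rule, to directional
    derivatives. *)
Lemma is_derive_line {V W} (f : V -> W) x v df : is_derive x v f df <->
  is_derive (0 : R) (1 : R) (fun h => f (h *: v + x)) df.
Proof.
rewrite !is_deriveP.
suff -> : (fun h : R => h^-1 *: (f ((h *: (1 : R) + 0) *: v + x) -
    f ((0 : R) *: v + x))) = (fun h : R => h^-1 *: (f (h *: v + x) - f x)) by [].
apply/funext => h; rewrite scale0r add0r addr0.
by rewrite (_ : h *: (1 : R) = h) //; exact: mulr1.
Qed.

Lemma is_derive_comp1 {V} (g : R -> R) (f : V -> R) x v dg df :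
  is_derive (f x) (1 : R) g dg -> is_derive x v f df ->
  is_derive x v (g \o f) (dg * df).
Proof.
move=> gd /is_derive_line fd; apply/is_derive_line.
apply: (@is_derive1_comp R g (fun h : R => f (h *: v + x))).
by rewrite scale0r add0r.
Qed.

(** Both claims are proved together because differentiation exchanges the two
    functions. *)
Lemma Ck_sin_cos {V} k (f : V -> R) : Ck_on k setT (f : V -> R^o) ->
  Ck_on k setT (sin \o f : V -> R^o) /\ Ck_on k setT (cos \o f : V -> R^o).
Proof.
elim: k f => [|k IH] f Cf; have cf := Ck_onS_continuous Cf.
  split=> x _; apply: continuous_comp (cf x) _.
    exact: continuous_sin.
  exact: continuous_cos.
have [Cs Cc] := IH _ (Ck_on_le Cf).
have [_ df] := Cf.
have ds x v : is_derive x v (sin \o f) (cos (f x) * 'D_v f x).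
  apply: is_derive_comp1; apply: derivableP; by have [+ _] := df v; apply.
have dc x v : is_derive x v (cos \o f) (- sin (f x) * 'D_v f x).
  apply: is_derive_comp1; apply: derivableP; by have [+ _] := df v; apply.
split; split.
- by move=> x _; apply: continuous_comp (cf x) _; exact: continuous_sin.
- move=> v; have [dv Dv] := df v; split; first by move=> x _; case: (ds x v).
  rewrite (_ : 'D_v _ = (cos \o f) \* 'D_v f); first exact: CkM.
  by apply/funext => x; rewrite (@derive_val _ _ _ _ _ _ _ (ds x v)).
- by move=> x _; apply: continuous_comp (cf x) _; exact: continuous_cos.
- move=> v; have [dv Dv] := df v; split; first by move=> x _; case: (dc x v).
  rewrite (_ : 'D_v _ = cst (-1) \* ((sin \o f) \* 'D_v f)).
    by apply: CkM; [exact: smooth_cst|exact: CkM].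
  apply/funext => x; rewrite (@derive_val _ _ _ _ _ _ _ (dc x v)) /=.
  by rewrite mulN1r mulNr.
Qed.

Lemma smooth_additive {V} {W} (L : V -> W) : continuous L ->
  (forall (h : R) v x, L (h *: v + x) = h *: L v + L x) -> smooth_on setT L.
Proof.
move=> cL lin [|k] /=; first by move=> x _; exact: cL.
have dL x v : is_derive x v L (L v).
  apply/is_deriveP; apply: cvg_near_cst; near=> h.
  rewrite lin addrK scalerA mulVf ?scale1r//.
  by near: h; exact: nbhs_dnbhs_neq.
split; first by move=> x _; exact: cL.
move=> v; split; first by move=> x _; case: (dL x v).
rewrite (_ : 'D_v _ = cst (L v)); first exact: smooth_cst.
by apply/funext => x; rewrite (@derive_val _ _ _ _ _ _ _ (dL x v)).
Unshelve. all: by end_near. Qed.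

End SmoothCalculus.

(** * The flat torus *)

Lemma norm_coord_le {R : realType} {n} (v : 'rV[R]_n) i : `|v 0 i| <= `|v|.
Proof.
rewrite [leRHS]/Num.Def.normr/= mx_normrE.
exact: (le_bigmax _ (fun ij : 'I_1 * 'I_n => `|v ij.1 ij.2|) (0, i)).
Qed.

Lemma norm_rV_lt {R : realType} {n} (v : 'rV[R]_n) e : 0 < e ->
  (forall i, `|v 0 i| < e) -> `|v| < e.
Proof.
move=> e0 H; rewrite /Num.Def.normr/= mx_normrE.
by apply: bigmax_lt => //= -[i j] _; rewrite (ord1 i).
Qed.

Section Torus.
Context {R : realType} {n : nat}.
Local Notation V := 'rV[R]_n.
Implicit Types (x y c v w : V).

Definition lattice : pred V := [pred v : V | [forall i, v 0 i \is a Num.int]].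

Lemma latticeP v : reflect (forall i, v 0 i \is a Num.int) (v \in lattice).
Proof. exact: forallP. Qed.

Lemma lattice0 : 0 \in lattice.
Proof. by apply/latticeP => i; rewrite mxE rpred0. Qed.

Lemma latticeN v : v \in lattice -> - v \in lattice.
Proof. by move=> /latticeP v_int; apply/latticeP => i; rewrite mxE rpredN. Qed.

Lemma latticeD v w : v \in lattice -> w \in lattice -> v + w \in lattice.
Proof.
by move=> /latticeP vi /latticeP wi; apply/latticeP => i; rewrite mxE rpredD.
Qed.

Lemma lattice_lt1 v : v \in lattice -> `|v| < 1 -> v = 0.
Proof.
move=> /latticeP v_int v1; apply/rowP => i; rewrite mxE.
apply/eqP; apply: contraTT (v1) => vi0; rewrite -leNgt.
by apply: le_trans (norm_coord_le v i); rewrite norm_intr_ge1.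
Qed.

Definition congr_lattice x y := x - y \in lattice.

Lemma congr_lattice_refl : reflexive congr_lattice.
Proof. by move=> x; rewrite /congr_lattice subrr lattice0. Qed.

Lemma congr_lattice_sym : symmetric congr_lattice.
Proof.
by move=> x y; apply/idP/idP => /latticeN; rewrite opprB.
Qed.

Lemma congr_lattice_trans : transitive congr_lattice.
Proof.
by move=> y x z xy yz; have := latticeD xy yz; rewrite addrA subrK.
Qed.

Canonical congr_lattice_equiv :=
  EquivRel congr_lattice congr_lattice_refl congr_lattice_sym congr_lattice_trans.

Definition torus : topologicalType :=
  quotient_topology {eq_quot congr_lattice}%qT.

Definition tproj x : torus := (\pi_(quotient_topology {eq_quot congr_lattice}) x)%qT.

Lemma tprojP x y : tproj x = tproj y <-> x - y \in lattice.
Proof. by split => [/eqquotP|xy]; [|exact/eqquotP]. Qed.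

Lemma tproj_surj (p : torus) : exists x, tproj x = p.
Proof. by exists (repr (p : quotient_topology _)); rewrite /tproj reprK. Qed.

Lemma tprojD x v : v \in lattice -> tproj (x + v) = tproj x.
Proof. by move=> vL; apply/tprojP; rewrite addrC addKr. Qed.

Lemma tproj_continuous : continuous tproj.
Proof. exact: pi_continuous. Qed.

Lemma cvg_addr x v : (y + v) @[y --> x] --> x + v.
Proof. exact: (@cvgD _ V V (nbhs x) _ id (cst v) x v cvg_id (cvg_cst _)). Qed.

(** The projection is open because the preimage of the image of an open set is
    the union of its lattice translates. *)
Lemma tproj_open (A : set V) : open A -> open (tproj @` A).
Proof.
move=> oA; rewrite /open /= /quotient_open /= openE => x [a Aa ax].
have shift_cvg : (y + (a - x)) @[y --> x] --> a.
  have := @cvg_addr x (a - x); rewrite [X in _ --> X]addrC subrK; exact.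
have : nbhs a A by exact: open_nbhs_nbhs.
move=> /shift_cvg; apply: (@filterS _ (nbhs x) _) => y Ay; exists (y + (a - x)) => //.
by apply: tprojD; exact/tprojP.
Qed.

(** The index of a chart is the centre of a unit box; its inverse is the
    projection, whatever the box. *)
Definition box c : set V := [set x | `|x - c| < 2^-1].

Lemma box_open c : open (box c).
Proof.
rewrite (_ : box c = ball c 2^-1); first exact: ball_open.
by rewrite -ball_normE; apply/seteqP; split => x; rewrite /box /= distrC.
Qed.

Lemma box_center c : box c c.
Proof. by rewrite /box /= subrr normr0 invr_gt0. Qed.

(** Two congruent points of a box differ by a lattice vector of norm less
    than 1, which is zero. *)
Lemma box_inj c x y : box c x -> box c y -> tproj x = tproj y -> x = y.
Proof.
rewrite /box /= => cx cy /tprojP xyL; apply/eqP; rewrite -subr_eq0; apply/eqP.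
apply: lattice_lt1 => //.
rewrite -(subrKA c).
rewrite (le_lt_trans (ler_normD _ _))// [X in _ < X](splitr 1) div1r.
by apply: ltrD => //; rewrite distrC.
Qed.

Definition tdom c : set torus := tproj @` box c.
Definition tchart c (p : torus) : V := xget 0 [set x | box c x /\ tproj x = p].

Lemma tchartP c p : tdom c p -> box c (tchart c p) /\ tproj (tchart c p) = p.
Proof.
move=> [x cx xp]; rewrite /tchart.
by case: xgetP => [_ -> //|/(_ x)]; case.
Qed.

Lemma tchartK c : {in tdom c, cancel (tchart c) tproj}.
Proof. by move=> p /set_mem /tchartP[]. Qed.

Lemma tchart_proj c x : box c x -> tchart c (tproj x) = x.
Proof.
move=> cx; have [cy yx] := @tchartP c (tproj x) (ex_intro2 _ _ x cx erefl).
exact: (@box_inj c).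
Qed.

Lemma tdom_open c : open (tdom c).
Proof. exact/tproj_open/box_open. Qed.

Lemma tdom_center c : tdom c (tproj c).
Proof. by exists c => //; exact: box_center. Qed.

Lemma tchart_image c (U : set torus) :
  tchart c @` (U `&` tdom c) = box c `&` tproj @^-1` U.
Proof.
apply/seteqP; split=> [_ [p [Up /tchartP[cp pE]] <-]|x [cx Ux]].
  by split => //; rewrite /preimage /= pE.
by exists (tproj x); [split => //; exists x|rewrite tchart_proj].
Qed.

Lemma tchart_imageT c : tchart c @` tdom c = box c.
Proof. by rewrite -[tdom c]setTI tchart_image preimage_setT setIT. Qed.

Lemma tchart_image_open c U : open U -> open (tchart c @` (U `&` tdom c)).
Proof.
move=> oU; rewrite tchart_image; apply: openI; first exact: box_open.
by have /continuousP := tproj_continuous; apply.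
Qed.

Lemma tchart_continuous c : {in tdom c, continuous (tchart c)}.
Proof.
move=> p /set_mem /tchartP[cp pE] A /=; rewrite nbhsE => -[B [oB Bp] BA].
have -> : nbhs p = nbhs (tproj (tchart c p)) by rewrite pE.
apply: (@filterS _ _ _ (tproj @` (box c `&` B))).
  by move=> _ [x [cx Bx] <-] /=; apply: BA; rewrite tchart_proj.
apply: open_nbhs_nbhs; split; last by exists (tchart c p).
by apply: tproj_open; apply: openI oB; exact: box_open.
Qed.

(** Rounding the difference of two representatives puts them at distance
    less than 1 in every coordinate; their midpoint is then a box centre. *)
Lemma common_box x y : exists c x' y',
  [/\ box c x', box c y', tproj x' = tproj x & tproj y' = tproj y].
Proof.
pose k : V := \row_i (Num.floor (y 0 i - x 0 i))%:~R.
have kL : k \in lattice by apply/latticeP => i; rewrite mxE intr_int.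
exists (2^-1 *: (x + (y - k))), x, (y - k); split => //.
- apply: norm_rV_lt => [|i]; first by rewrite invr_gt0.
  rewrite !mxE; have /andP[] := floor_itv (y 0 i - x 0 i).
  by rewrite intrD; set f := (Num.floor _)%:~R => f0 f1; rewrite ltr_norml; lra.
- apply: norm_rV_lt => [|i]; first by rewrite invr_gt0.
  rewrite !mxE; have /andP[] := floor_itv (y 0 i - x 0 i).
  by rewrite intrD; set f := (Num.floor _)%:~R => f0 f1; rewrite ltr_norml; lra.
- by rewrite tprojD// latticeN.
Qed.

(** Any two points lie in a common chart, which is Hausdorff. *)
Lemma torus_hausdorff : hausdorff_space torus.
Proof.
move=> p q; have [x0 <-] := tproj_surj p; have [y0 <-] := tproj_surj q.
have [c [x [y [cx cy <- <-]]]] := common_box x0 y0 => clxy.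
have [->//|xy] := eqVneq x y; exfalso.
pose r := `|x - y| / 2.
have r0 : 0 < r by rewrite divr_gt0// normr_gt0 subr_eq0.
have nb z : box c z -> nbhs (tproj z) (tproj @` (box c `&` ball z r)).
  move=> cz; apply: open_nbhs_nbhs; split.
    by apply: tproj_open; apply: openI; [exact: box_open|exact: ball_open].
  by exists z => //; split => //; exact: ballxx.
have [_ [[a [ca xa] <-] [b [cb yb] /esym ab]]] := clxy _ _ (nb x cx) (nb y cy).
have ab' := box_inj ca cb ab; rewrite -{}ab' in yb.
move: xa yb; rewrite -ball_normE /ball_ /= => xa; rewrite distrC => ya.
have := ler_normD (x - a) (a - y); rewrite addrA subrK leNgt => /negP; apply.
by rewrite (splitr `|x - y|) ltrD.
Qed.

(** Subtracting integer parts moves every point into the unit cube. *)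
Lemma torus_compact : compact [set: torus].
Proof.
pose C : set V := [set v | forall i, `[0, 1]%classic (v ord0 i)].
have -> : [set: torus] = tproj @` C.
  apply/seteqP; split => // p _; have [x <-] := tproj_surj p.
  pose k : V := \row_i (Num.floor (x 0 i))%:~R.
  exists (x - k); last first.
    rewrite tprojD//; apply: latticeN; apply/latticeP => i.
    by rewrite mxE intr_int.
  move=> i; rewrite /= !mxE in_itv /=; have /andP[] := floor_itv (x 0 i).
  by rewrite intrD; set f := (Num.floor _)%:~R => f0 f1; apply/andP; split; lra.
apply: continuous_compact.
  by apply: continuous_subspaceT => x; exact: tproj_continuous.
exact: (@rV_compact R n (fun=> `[0, 1]%classic) (fun=> @segment_compact R 0 1)).
Qed.

(** The images of the balls with rational centre and radius [1 / m.+1] form a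
    basis, because the projection is open. *)
Lemma torus_second_countable : @second_countable torus.
Proof.
pose b (qm : 'rV[rat]_n * nat) : set torus :=
  tproj @` ball (map_mx ratr qm.1 : V) (qm.2.+1%:R^-1 : R).
exists (range b); first exact: sub_countable (card_image_le _ _) (countableP _).
split=> [_ [qm _ <-]|p A].
  exact/tproj_open/ball_open.
have [x <-] := tproj_surj p => /tproj_continuous /nbhs_ballP[e /= e0 eA].
have [m me] : exists m : nat, m.+1%:R^-1 < e / 2.
  have [m _ me] := near_infty_natSinv_lt (PosNum (divr_gt0 e0 (ltr0n _ 2))).
  by exists m; exact: (me m (leqnn m)).
have m0 : 0 < m.+1%:R^-1 :> R by rewrite invr_gt0.
set d : R := m.+1%:R^-1 in me m0.
have [q qx] : exists q : 'rV[rat]_n, ball (map_mx ratr q : V) d x.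
  have H i : exists q : rat, `|ratr q - x 0 i| < d.
    have lt_x : x 0 i - d < x 0 i + d by lra.
    have [q] := rat_in_itvoo lt_x; rewrite in_itv /= => /andP[q1 q2].
    by exists q; rewrite ltr_norml; lra.
  exists (\row_i sval (cid (H i))); rewrite -ball_normE /=.
  by apply: norm_rV_lt => // i; rewrite !mxE; case: cid.
exists (b (q, m)).
  by split; [exists (q, m)|exists x].
move=> _ [y qy <-]; apply: eA => /=.
apply: (@ball_splitr _ _ (map_mx ratr q : V)).
  by apply: le_ball qx; exact: ltW.
by apply: le_ball qy; exact: ltW.
Qed.

(** Reading a point in another chart adds a lattice vector, which is locally
    constant; so every coordinate change has the identity as differential. *)
Lemma tchart_near_shift c x : tdom c (tproj x) ->
  exists k, \forall y \near x, tchart c (tproj y) = y + k.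
Proof.
move=> /tchartP[cz zx]; set z := tchart c _ in cz zx.
exists (z - x).
have shift_cvg : (y + (z - x)) @[y --> x] --> z.
  have := @cvg_addr x (z - x); rewrite [X in _ --> X]addrC subrK; exact.
have : nbhs z (box c) by apply: open_nbhs_nbhs; split => //; exact: box_open.
move=> /shift_cvg; apply: (@filterS _ (nbhs x) _) => y cy.
by rewrite -{1}(@tprojD y (z - x)) ?tchart_proj//; exact/tprojP.
Qed.

Lemma is_derive_near_shift x v k (f : V -> V) :
  (\forall y \near x, f y = y + k) -> is_derive x v f v.
Proof.
move=> fk; apply: (@near_eq_is_derive _ _ _ (fun y => y + k)).
  by apply: filterS fk => y ->.
rewrite -[X in is_derive _ _ _ X]addr0.
exact: is_deriveD.
Qed.

Lemma transition_derive c x v : tdom c (tproj x) ->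
  is_derive x v (tchart c \o tproj) v.
Proof. by move=> /tchart_near_shift[k]; exact: is_derive_near_shift. Qed.

Lemma torus_transition_smooth c d :
  smooth_on (tchart c @` (tdom c `&` tdom d)) (tchart d \o tproj).
Proof.
rewrite setIC; set U := _ @` _.
have oU : open U by apply: tchart_image_open; exact: tdom_open.
have Ud x : U x -> tdom d (tproj x) by rewrite /U tchart_image => -[].
have cont : {in U, continuous (tchart d \o tproj)}.
  move=> x /set_mem /Ud dx; apply: continuous_comp; first exact: tproj_continuous.
  by apply: tchart_continuous; rewrite inE.
move=> [|k] //=; split => // v; split.
  by move=> x /Ud dx; case: (transition_derive v dx).
apply: (@Ck_on_eq _ _ _ _ _ (cst v)) => //; last exact: smooth_cst.
by move=> x /set_mem /Ud dx; case: (transition_derive v dx) => _ ->.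
Qed.

Definition torus_manifold : smooth_manifold R n.
Proof.
refine (@SmoothManifold R n torus V tdom tchart (fun=> tproj)
  torus_hausdorff torus_second_countable _ tdom_open _ tchartK
  tchart_continuous _ torus_transition_smooth).
- by move=> p; have [x <-] := tproj_surj p; exists x; exact: tdom_center.
- by move=> c; rewrite tchart_imageT; exact: box_open.
- by move=> c x _; exact: tproj_continuous.
Defined.

Lemma torus_trans_diff (c d : V) (p : torus_manifold) (u : V) :
  tdom c p -> tdom d p -> @trans_diff R n torus_manifold c d p u = u.
Proof.
move=> cp dp; have [_ E] := tchartP cp.
have := @transition_derive d (tchart c p) u; rewrite E => /(_ dp).
by case.
Qed.

End Torus.

(** * Functions of two real variables *)

Section Analysis.
Context {R : realType}.
Local Notation leb := (@lebesgue_measure R).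
Implicit Types (f g : R -> R) (F : R -> R -> R) (x y : R).

Definition continuous2 F := continuous (fun z : R * R => F z.1 z.2).

Lemma continuous2_r F x : continuous2 F -> continuous (F x).
Proof.
move=> cF y; apply: (@continuous_comp _ _ _ (fun y => (x, y)) (fun z => F z.1 z.2)).
  exact: (@cvg_pair R R R (nbhs y) (nbhs x) (nbhs y) _ _ _ (cst x) id
    (cvg_cst x) cvg_id).
exact: cF.
Qed.

Lemma continuous2_max F : continuous2 F -> forall a b c d, a <= b -> c <= d ->
  exists z : R * R, [/\ z.1 \in `[a, b], z.2 \in `[c, d] &
    forall x y, x \in `[a, b] -> y \in `[c, d] -> F x y <= F z.1 z.2].
Proof.
move=> cF a b c d ab cd.
have A0 : `[a, b]%classic `*` `[c, d]%classic !=set0.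
  by exists (a, c); split; rewrite /= in_itv /= lexx.
have := @compact_EVT_max _ R (fun z => F z.1 z.2) _ A0
  (compact_setX (@segment_compact _ a b) (@segment_compact _ c d)).
case; first by apply: continuous_subspaceT => z; exact: cF.
move=> z /set_mem[za zc] zmax; exists z; split => // x y xab ycd.
by apply: (zmax (x, y)); rewrite inE.
Qed.

Lemma continuous2_bounded F : continuous2 F -> forall a b c d, a <= b -> c <= d ->
  exists M, forall x y, x \in `[a, b] -> y \in `[c, d] -> `|F x y| <= M.
Proof.
move=> cF a b c d ab cd.
have cN : continuous2 (fun x y => `|F x y|).
  by move=> z; apply: (@continuous_comp _ _ _ (fun z => F z.1 z.2) Num.norm);
    [exact: cF|exact: norm_continuous].
by have [z [_ _ H]] := continuous2_max cN ab cd; exists `|F z.1 z.2|.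
Qed.

Lemma is_derive_continuous f df x : is_derive x (1:R) f df -> {for x, continuous f}.
Proof. by case=> /derivable1_diffP /differentiable_continuous. Qed.

Lemma norm_increment f df (M a b : R) :
  (forall t, is_derive t (1:R) f (df t)) ->
  (forall t, t \in `[a, b] -> `|df t| <= M) ->
  {in `[a, b] &, forall x y, `|f x - f y| <= M * `|x - y|}.
Proof.
move=> dF dM x y.
wlog xy : x y / y <= x => [H xab yab|xab yab].
  have [|/ltW] := leP y x; first by move=> /H; exact.
  by rewrite distrC [`|x - y|]distrC => /H; exact.
have [t txy ->] := @MVT_segment R f df y x xy (fun t _ => dF t)
  (continuous_subspaceT (fun t => is_derive_continuous (dF t))).
rewrite normrM ler_wpM2r// dM//.
by move: txy xab yab; rewrite !in_itv /=; lra.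
Qed.

(** Bounded partial derivatives make the function Lipschitz in each variable,
    uniformly in the other one. *)
Lemma continuous2_partials F Fx Fy :
  (forall x y, is_derive x (1:R) (F^~ y) (Fx x y)) ->
  (forall x y, is_derive y (1:R) (F x) (Fy x y)) ->
  continuous2 Fx -> continuous2 Fy -> continuous2 F.
Proof.
move=> dx dy cx cy [x0 y0].
have [/= xl yl] : x0 - 1 <= x0 + 1 /\ y0 - 1 <= y0 + 1 by lra.
have [Mx Mx_ub] := continuous2_bounded cx xl yl.
have [My My_ub] := continuous2_bounded cy xl yl.
apply/cvgrPdist_lt => e e0 /=.
pose M := `|Mx| + `|My| + 1.
have M0 : 0 < M by rewrite /M; have := normr_ge0 Mx; have := normr_ge0 My; lra.
pose d := Num.min 1 (e / (2 * M)).
have d0 : 0 < d by rewrite lt_min ltr01 divr_gt0// mulr_gt0.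
have [d1 dM] : d <= 1 /\ d * (2 * M) <= e.
  split; first by rewrite ge_min lexx.
  by rewrite -ler_pdivlMr ?mulr_gt0// ge_min lexx orbT.
exists (ball x0 d, ball y0 d) => /=.
  by split; exact: nbhsx_ballx.
move=> [x y] [/=]; rewrite -!ball_normE /ball_ /= => xd yd.
have [xi yi] : x \in `[x0 - 1, x0 + 1] /\ y \in `[y0 - 1, y0 + 1].
  by move: xd yd; rewrite !in_itv /= !ltr_norml => /andP[? ?] /andP[? ?]; split;
    apply/andP; split; lra.
have [x0i y0i] : x0 \in `[x0 - 1, x0 + 1] /\ y0 \in `[y0 - 1, y0 + 1].
  by rewrite !in_itv /=; split; apply/andP; split; lra.
have Hx := norm_increment (fun t => dx t y) (fun t ti => Mx_ub t y ti yi) x0i xi.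
have Hy := norm_increment (dy x0) (fun t => My_ub x0 t x0i) y0i yi.
have -> : F x0 y0 - F x y = (F x0 y0 - F x0 y) + (F x0 y - F x y) by ring.
apply: le_lt_trans (ler_normD _ _) _.
apply: (@le_lt_trans _ _ (M * `|y0 - y| + M * `|x0 - x|)).
  apply: lerD; [apply: le_trans Hy _|apply: le_trans Hx _].
    apply: ler_wpM2r => //; rewrite /M; have := ler_norm My; have := normr_ge0 Mx; lra.
  apply: ler_wpM2r => //; rewrite /M; have := ler_norm Mx; have := normr_ge0 My; lra.
rewrite -mulrDr (lt_le_trans _ dM)// (_ : d * (2 * M) = M * (d + d)); last by ring.
by rewrite ltr_pM2l// ltrD.
Qed.

Lemma is_derive_integral01 (h dh : R -> R -> R) (a M : R) :
  (forall x s, is_derive x (1:R) (h^~ s) (dh x s)) ->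
  (forall x, continuous (h x)) ->
  (forall x s, x \in `]a - 1, a + 1[ -> s \in `[0, 1] -> `|dh x s| <= M) ->
  is_derive a (1:R) (fun x => \int[leb]_(s in `[0, 1]) h x s)
    (\int[leb]_(s in `[0, 1]) dh a s).
Proof.
move=> hd hc hM.
have Ia : `]a - 1, a + 1[%classic a by rewrite /= in_itv /=; lra.
have int_cont f : continuous f -> leb.-integrable `[0, 1] (EFin \o f).
  move=> cf; apply: continuous_compact_integrable; first exact: segment_compact.
  exact: continuous_subspaceT.
have dhE x s : partial1of2 h x s = dh x s.
  by rewrite partial1of2E; case: (hd x s).
have ub x s : `]a - 1, a + 1[%classic x -> `[0, 1]%classic s ->
    `|partial1of2 h x s| <= cst `|M| s.
  move=> xI sI; rewrite dhE /=; apply: le_trans (ler_norm M); exact: hM.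
have args := (fun x (_ : `]a - 1, a + 1[%classic x) => int_cont _ (hc x),
   fun x s (_ : `]a - 1, a + 1[%classic x) (_ : `[0, 1]%classic s) =>
    @ex_derive _ _ _ _ _ _ _ (hd x s)).
have intM : leb.-integrable `[0, 1] (EFin \o cst `|M|).
  exact: int_cont _ (@cst_continuous _ _ _).
split.
  exact: (@derivable_under_integral R _ _ leb h `[0, 1]%classic _ a _ _ Ia
    args.1 args.2 (cst `|M|) (fun=> normr_ge0 M) intM ub).
rewrite -derive1E.
rewrite (@differentiation_under_integral R _ _ leb h `[0, 1]%classic _ a _ _ Ia
    args.1 args.2 (cst `|M|) (fun=> normr_ge0 M) intM ub)//.
by apply: eq_Rintegral => s _; rewrite dhE.
Qed.

Lemma integral01_derive f df : (forall s, is_derive s (1:R) f (df s)) ->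
  continuous df -> \int[leb]_(s in `[0, 1]) df s = f 1 - f 0.
Proof.
move=> fd cdf; have cf x := is_derive_continuous (fd x).
rewrite /Rintegral (@continuous_FTC2 _ df f)//.
- exact: continuous_subspaceT.
- split.
  + by move=> x _; case: (fd x).
  + by apply: cvg_at_right_filter; exact: cf.
  + by apply: cvg_at_left_filter; exact: cf.
- by move=> x _; rewrite derive1E; case: (fd x).
Qed.

End Analysis.

(** * Twisted closed 1-forms on the 2-torus *)

Section Potential.
Context {R : realType}.
Local Notation leb := (@lebesgue_measure R).
Implicit Types (F P Q D : R -> R -> R) (x y m : R).

Lemma is_derive_translate (f : R -> R) df x s :
  is_derive (x + s) (1:R) f df -> is_derive x (1:R) (fun x => f (x + s)) df.
Proof.
move=> fd; rewrite -[df]mulr1; apply: (@is_derive1_comp R f (fun x => x + s)).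
rewrite -[X in is_derive _ _ _ X]addr0; exact: is_deriveD.
Qed.

Lemma is_derive_translatel (f : R -> R) df x s :
  is_derive (s + x) (1:R) f df -> is_derive x (1:R) (fun x => f (s + x)) df.
Proof.
rewrite addrC => /is_derive_translate.
by rewrite (_ : (fun x => f (x + s)) = (fun x => f (s + x)))//;
  apply/funext => z; rewrite addrC.
Qed.

(** The integral of the closed form [P dx + Q dy] over the vertical unit segment
    starting at [(x, y)] is [m - 1] times its primitive with multiplier [m].
    Defining the primitive in this way needs neither a base point nor a
    constant of integration, and gives it the right periods at once. *)
Lemma twisted_primitive P Q D E m : continuous2 P -> continuous2 Q ->
  continuous2 D -> continuous2 E ->
  (forall x y, is_derive y (1:R) (P x) (D x y)) ->
  (forall x y, is_derive x (1:R) (Q^~ y) (D x y)) ->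
  (forall x y, is_derive y (1:R) (Q x) (E x y)) ->
  (forall x y, P x (y + 1) = m * P x y) ->
  (forall x y, Q x (y + 1) = m * Q x y) ->
  (forall x y, Q (x + 1) y = Q x y) ->
  exists F : R -> R -> R, [/\
    forall x y, is_derive x (1:R) (F^~ y) ((m - 1) * P x y),
    forall x y, is_derive y (1:R) (F x) ((m - 1) * Q x y),
    forall x y, F (x + 1) y = F x y &
    forall x y, F x (y + 1) = m * F x y].
Proof.
move=> cP cQ cD cE dyP dxQ dyQ mP mQ perQ.
have cr G x y : continuous2 G -> continuous (fun s : R => G x (y + s)).
  move=> cG s; apply: (@continuous_comp _ _ _ (fun s => y + s) (G x)).
    by apply: cvgD; [exact: cvg_cst|exact: cvg_id].
  exact: continuous2_r.
exists (fun x y => \int[leb]_(s in `[0, 1]) Q x (y + s)); split=> [x y|x y|x y|x y].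
- have -> : (m - 1) * P x y = P x (y + 1) - P x (y + 0) by rewrite addr0 mP; ring.
  have <- := @integral01_derive R (fun s => P x (y + s)) (fun s => D x (y + s))
    (fun s => is_derive_translatel (dyP x (y + s))) (cr _ x y cD).
  have [xl yl] : x - 1 <= x + 1 /\ y + 0 <= y + 1 by lra.
  have [M ub] := continuous2_bounded cD xl yl.
  apply: (@is_derive_integral01 R (fun x s => Q x (y + s)) (fun x s => D x (y + s)) x M
    (fun z s => dxQ z (y + s)) (fun z => cr _ z y cQ)) => z s zx s01.
  apply: ub; first exact: subset_itv_oo_cc.
  by move: s01; rewrite !in_itv /=; lra.
- have -> : (m - 1) * Q x y = Q x (y + 1) - Q x (y + 0) by rewrite addr0 mQ; ring.
  have <- := @integral01_derive R (fun s => Q x (y + s)) (fun s => E x (y + s))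
    (fun s => is_derive_translatel (dyQ x (y + s))) (cr _ x y cE).
  have [xl yl] : x <= x /\ y - 1 <= y + 2 by lra.
  have [M ub] := continuous2_bounded cE xl yl.
  apply: (@is_derive_integral01 R (fun y s => Q x (y + s)) (fun y s => E x (y + s)) y M
    (fun z s => is_derive_translate (dyQ x (z + s))) (fun z => cr _ x z cQ)) => z s zy s01.
  apply: ub; first by rewrite in_itv /= lexx.
  by move: zy s01; rewrite !in_itv /=; lra.
- by apply: eq_Rintegral => s _; rewrite perQ.
- rewrite -RintegralZl//; last first.
    apply: continuous_compact_integrable; first exact: segment_compact.
    by apply: continuous_subspaceT; exact: cr.
  by apply: eq_Rintegral => s _; rewrite addrAC mQ.
Qed.

Lemma periodic_int (f : R -> R) : (forall x, f (x + 1) = f x) ->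
  forall (k : int) x, f (x + k%:~R) = f x.
Proof.
move=> f1; have fn (n : nat) x : f (x + n%:R) = f x.
  by elim: n => [|n IH]; rewrite ?addr0// -natr1 addrA f1.
move=> [n|n] x; first exact: fn.
by rewrite NegzE mulrNz -(fn n.+1 (x - _)) subrK.
Qed.

Lemma periodic2_max F : continuous2 F ->
  (forall x y, F (x + 1) y = F x y) -> (forall x y, F x (y + 1) = F x y) ->
  exists a b, forall x y, F x y <= F a b.
Proof.
move=> cF Fx Fy; have [[a b] [_ _ ub]] := continuous2_max cF ler01 ler01.
exists a, b => x y.
have unit_part (z : R) : z - (Num.floor z)%:~R \in `[0, 1].
  have /andP[] := floor_itv z; rewrite intrD in_itv /=.
  by set f := (Num.floor z)%:~R => ? ?; lra.
rewrite -(periodic_int (fun x => Fx x y) (- Num.floor x)).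
rewrite -(periodic_int (fun y => Fy _ y) (- Num.floor y)) !mulrNz.
exact: ub.
Qed.

Lemma is_derive_at_max (f df : R -> R) a :
  (forall x, is_derive x (1:R) f (df x)) -> (forall x, f x <= f a) -> df a = 0.
Proof.
move=> fd fmax.
have [] := @derive1_at_max R f (a - 1) (a + 1) a.
- by lra.
- by move=> t _; case: (fd t).
- by rewrite in_itv /=; lra.
- by [].
by case: (fd a) => _ <-.
Qed.

Lemma is_derive_exp_mul (f : R -> R) df l y : is_derive y (1:R) f df ->
  is_derive y (1:R) (fun y => expR (l * y) * f y) (expR (l * y) * (df + l * f y)).
Proof.
move=> fd.
have ed : is_derive y (1:R) (fun y => expR (l * y)) (expR (l * y) * l).
  apply: (@is_derive1_comp R expR (fun y => l * y)).
  rewrite -[X in is_derive _ _ _ X]mulr1; exact: is_deriveZ.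
have := @is_deriveM _ _ _ _ _ _ _ _ ed fd.
congr is_derive; rewrite /GRing.scale /=; ring.
Qed.

Lemma continuous2_exp_mul l F : continuous2 F ->
  continuous2 (fun x y => expR (l * y) * F x y).
Proof.
move=> cF z; apply: cvgM; last exact: cF.
apply: (@continuous_comp _ _ _ (fun z : R * R => l * z.2) expR); last first.
  exact: continuous_expR.
by apply: cvgM; [exact: cvg_cst|exact: cvg_snd].
Qed.

Lemma continuous2D F G : continuous2 F -> continuous2 G ->
  continuous2 (fun x y => F x y + G x y).
Proof. by move=> cF cG z; apply: cvgD; [exact: cF|exact: cG]. Qed.

Lemma continuous2M F G : continuous2 F -> continuous2 G ->
  continuous2 (fun x y => F x y * G x y).
Proof. by move=> cF cG z; apply: cvgM; [exact: cF|exact: cG]. Qed.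

(** Says that [e^(l y) (p dx + q dy)] is closed for doubly periodic [p] and [q]:
    this is a closed 1-form on the 2-torus with values in the flat line bundle whose
    holonomy is [e^l] along [y] and trivial along [x]. *)
Definition twisted_closed l (p q : R -> R -> R) := exists py qx qy,
  [/\ [/\ continuous2 p, continuous2 q, continuous2 py & continuous2 qy],
      [/\ forall x y, is_derive y (1:R) (p x) (py x y),
          forall x y, is_derive x (1:R) (q^~ y) (qx x y),
          forall x y, is_derive y (1:R) (q x) (qy x y) &
          forall x y, qx x y = py x y + l * p x y],
      (forall x y, p x (y + 1) = p x y) /\ (forall x y, p (x + 1) y = p x y) &
      (forall x y, q x (y + 1) = q x y) /\ (forall x y, q (x + 1) y = q x y)].

Lemma twisted_potential l p q : twisted_closed l p q ->
  exists F : R -> R -> R, [/\ continuous2 F,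
    forall x y, is_derive x (1:R) (F^~ y) ((expR l - 1) * (expR (l * y) * p x y)),
    forall x y, is_derive y (1:R) (F x) ((expR l - 1) * (expR (l * y) * q x y)),
    forall x y, F (x + 1) y = F x y &
    forall x y, F x (y + 1) = expR l * F x y].
Proof.
move=> [py [qx [qy [[cp cq cpy cqy] [dyp dxq dyq qxE] [p1 _] [q1 q1']]]]].
have tw (g : R -> R -> R) : (forall x y, g x (y + 1) = g x y) -> forall x y,
    expR (l * (y + 1)) * g x (y + 1) = expR l * (expR (l * y) * g x y).
  by move=> g1 x y; rewrite g1 mulrDr mulr1 expRD; ring.
have cl (g : R -> R -> R) : continuous2 g -> continuous2 (fun x y => l * g x y).
  by apply: continuous2M => z; exact: cvg_cst.
have cD (g gy : R -> R -> R) : continuous2 g -> continuous2 gy ->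
    continuous2 (fun x y => expR (l * y) * (gy x y + l * g x y)).
  by move=> cg cgy; apply: continuous2_exp_mul; apply: continuous2D => //; exact: cl.
have cP := @continuous2_exp_mul l _ cp; have cQ := @continuous2_exp_mul l _ cq.
have [] := twisted_primitive (m := expR l) cP cQ (cD _ _ cp cpy) (cD _ _ cq cqy).
- by move=> x y; exact: is_derive_exp_mul.
- move=> x y; rewrite -qxE.
  exact: (@is_deriveZ _ _ _ (q^~ y) (expR (l * y)) x 1 (qx x y)).
- by move=> x y; exact: is_derive_exp_mul.
- exact: tw.
- exact: tw.
- by move=> x y; rewrite q1'.
move=> F [dxF dyF F1 F2]; exists F; split => //.
apply: (continuous2_partials dxF dyF).
  by apply: continuous2M => // z; exact: cvg_cst.
by apply: continuous2M => // z; exact: cvg_cst.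
Qed.

(** The product of the two potentials is doubly periodic because their
    multipliers are inverse to each other. At a critical point of that product
    nondegeneracy makes both potentials vanish, so its maximum and its minimum
    are zero; hence every point is critical and both potentials vanish
    identically, together with the forms they come from. *)
Lemma no_hyperbolic_coframe l p q r s : l != 0 ->
  twisted_closed l p q -> twisted_closed (- l) r s ->
  ~ (forall x y, p x y * s x y - r x y * q x y != 0).
Proof.
move=> l0 /twisted_potential[F [cF dxF dyF F1 F2]].
move=> /twisted_potential[G [cG dxG dyG G1 G2]] det0.
have exp_l k : k != 0 -> expR k - 1 != 0 :> R.
  move=> k0; rewrite subr_eq0; apply: contra k0 => /eqP ek.
  by rewrite -(expRK k) ek ln1.
have Nl0 : - l != 0 by rewrite oppr_eq0.
set c := expR l - 1 in dxF dyF; set d := expR (- l) - 1 in dxG dyG.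
have c0 : c != 0 by exact: exp_l.
have d0 : d != 0 by exact: exp_l.
pose H x y := F x y * G x y.
have cH : continuous2 H by exact: continuous2M.
have Hx x y : H (x + 1) y = H x y by rewrite /H F1 G1.
have Hy x y : H x (y + 1) = H x y.
  by rewrite /H F2 G2 mulrACA -expRD subrr expR0 mul1r.
pose DxH x y := G x y * (c * (expR (l * y) * p x y)) +
                F x y * (d * (expR (- l * y) * r x y)).
pose DyH x y := G x y * (c * (expR (l * y) * q x y)) +
                F x y * (d * (expR (- l * y) * s x y)).
have dxH x y : is_derive x (1:R) (H^~ y) (DxH x y).
  have := @is_deriveM _ _ _ _ _ _ _ _ (dxF x y) (dxG x y).
  by congr is_derive; rewrite /GRing.scale /= addrC.
have dyH x y : is_derive y (1:R) (H x) (DyH x y).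
  have := @is_deriveM _ _ _ _ _ _ _ _ (dyF x y) (dyG x y).
  by congr is_derive; rewrite /GRing.scale /= addrC.
have crit x y : DxH x y = 0 -> DyH x y = 0 -> F x y = 0 /\ G x y = 0.
  rewrite /DxH /DyH => hx hy; have dt := det0 x y.
  have e1 := expR_gt0 (l * y); have e2 := expR_gt0 (- l * y).
  have E1 : expR (l * y) != 0 by rewrite gt_eqF.
  have E2 : expR (- l * y) != 0 by rewrite gt_eqF.
  split; apply/eqP.
  - have : F x y * (d * expR (- l * y) * (p x y * s x y - r x y * q x y)) = 0.
      transitivity (p x y * (G x y * (c * (expR (l * y) * q x y)) +
                F x y * (d * (expR (- l * y) * s x y))) -
         q x y * (G x y * (c * (expR (l * y) * p x y)) +
                F x y * (d * (expR (- l * y) * r x y)))); first ring.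
      by rewrite hx hy; ring.
    by move/eqP; rewrite !mulf_eq0 (negbTE d0) (negbTE E2) (negbTE dt) !orbF.
  - have : G x y * (c * expR (l * y) * (p x y * s x y - r x y * q x y)) = 0.
      transitivity (s x y * (G x y * (c * (expR (l * y) * p x y)) +
                F x y * (d * (expR (- l * y) * r x y))) -
         r x y * (G x y * (c * (expR (l * y) * q x y)) +
                F x y * (d * (expR (- l * y) * s x y)))); first ring.
      by rewrite hx hy; ring.
    by move/eqP; rewrite !mulf_eq0 (negbTE c0) (negbTE E1) (negbTE dt) !orbF.
have H_le0 x y : H x y <= 0.
  have [a [b ub]] := periodic2_max cH Hx Hy.
  suff [Fab _] : F a b = 0 /\ G a b = 0.
    by apply: le_trans (ub x y) _; rewrite /H Fab mul0r.
  apply: crit; first exact: (is_derive_at_max (fun x => dxH x b) (ub^~ b)).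
  exact: (is_derive_at_max (dyH a) (ub a)).
have H_ge0 x y : 0 <= H x y.
  have cN : continuous2 (fun x y => - H x y) by move=> z; apply: cvgN; exact: cH.
  have [|x' y'|a [b ub]] := periodic2_max cN.
  - by move=> x' y'; rewrite Hx.
  - by rewrite Hy.
  suff [Fab _] : F a b = 0 /\ G a b = 0.
    by rewrite -oppr_le0; apply: le_trans (ub x y) _; rewrite /H Fab mul0r oppr0.
  apply: crit; apply/eqP; rewrite -oppr_eq0; apply/eqP.
    exact: (@is_derive_at_max (fun x => - H x b) (fun x => - DxH x b) a
      (fun x => is_deriveN (dxH x b)) (ub^~ b)).
  exact: (@is_derive_at_max (fun y => - H a y) (fun y => - DyH a y) b
    (fun y => is_deriveN (dyH a y)) (ub a)).
have H0 x y : H x y = 0 by apply/eqP; rewrite eq_le H_le0 H_ge0.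
have FG0 x y : F x y = 0 /\ G x y = 0.
  apply: crit; [apply: (is_derive_at_max (fun x => dxH x y))
               |apply: (is_derive_at_max (dyH x))] => z; by rewrite !H0.
have p0 : p 0 0 = 0.
  have /eqP : c * (expR (l * 0) * p 0 0) = 0.
    by apply: (is_derive_at_max (fun x => dxF x 0)) => x; rewrite !(FG0 _ _).1.
  by rewrite !mulf_eq0 (negbTE c0) gt_eqF ?expR_gt0//= => /eqP.
have r0 : r 0 0 = 0.
  have /eqP : d * (expR (- l * 0) * r 0 0) = 0.
    by apply: (is_derive_at_max (fun x => dxG x 0)) => x; rewrite !(FG0 _ _).2.
  by rewrite !mulf_eq0 (negbTE d0) gt_eqF ?expR_gt0//= => /eqP.
by have := det0 0 0; rewrite p0 r0 !mul0r subrr eqxx.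
Qed.

End Potential.

(** * Pointwise linear algebra *)

Definition i0 : 'I_(2 * 2) := @Ordinal 4 0 isT.
Definition i1 : 'I_(2 * 2) := @Ordinal 4 1 isT.
Definition i2 : 'I_(2 * 2) := @Ordinal 4 2 isT.
Definition i3 : 'I_(2 * 2) := @Ordinal 4 3 isT.

Lemma ord4_ind (P : 'I_(2 * 2) -> Prop) :
  P i0 -> P i1 -> P i2 -> P i3 -> forall i, P i.
Proof.
move=> P0 P1 P2 P3 [[|[|[|[|//]]]] im].
- by rewrite (_ : Ordinal im = i0)//; exact: val_inj.
- by rewrite (_ : Ordinal im = i1)//; exact: val_inj.
- by rewrite (_ : Ordinal im = i2)//; exact: val_inj.
- by rewrite (_ : Ordinal im = i3)//; exact: val_inj.
Qed.

Lemma sum4 {R : realType} (F : 'I_(2 * 2) -> R) :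
  \sum_i F i = F i0 + F i1 + F i2 + F i3.
Proof.
have -> : \sum_i F i = \sum_(i < 4) F i by [].
rewrite !big_ord_recl big_ord0 addr0 !addrA.
by congr (_ + _ + _ + _); congr F; exact: val_inj.
Qed.

Section Example.
Context {R : realType}.
Local Notation V := 'rV[R]_(2 * 2).
Local Notation M4 := 'M[R]_(2 * 2).
Local Notation T4 := (@torus_manifold R (2 * 2)).
Implicit Types (u v x y z : V) (t a b : R).

Lemma row4P u v : u 0 i0 = v 0 i0 -> u 0 i1 = v 0 i1 ->
  u 0 i2 = v 0 i2 -> u 0 i3 = v 0 i3 -> u = v.
Proof. by move=> *; apply/rowP; exact: ord4_ind. Qed.

Definition mx4 (s : seq (seq R)) : M4 := \matrix_(i, j) nth 0 (nth [::] s i) j.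

Local Notation e k := (delta_mx 0 k : V).

(** Acts on row vectors: [e2] and [e3] span the eigenspace for [-1], while [e0]
    and [e1 + (a / 2) e2 + (b / 2) e3] span the eigenspace for [1]. *)
Definition Kmx a b : M4 := mx4 [:: [:: 1; 0; 0; 0]; [:: 0; 1; a; b];
                                   [:: 0; 0; -1; 0]; [:: 0; 0; 0; -1]].

Lemma mul_Kmx u a b : [/\ (u *m Kmx a b) 0 i0 = u 0 i0,
  (u *m Kmx a b) 0 i1 = u 0 i1, (u *m Kmx a b) 0 i2 = a * u 0 i1 - u 0 i2 &
  (u *m Kmx a b) 0 i3 = b * u 0 i1 - u 0 i3].
Proof. by split; rewrite mxE sum4 !mxE /=; ring. Qed.

Lemma Kmx_invol a b : Kmx a b *m Kmx a b = 1%:M.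
Proof.
apply/row_matrixP => i; rewrite row_mul; set u := row i _.
have [k0 k1 k2 k3] := mul_Kmx u a b.
have -> : row i 1%:M = e i by rewrite rowE mulmx1.
by apply: row4P; rewrite ?k0 ?k1 ?k2 ?k3 /u !mxE; move: i {u k0 k1 k2 k3};
  apply: ord4_ind; rewrite /= ?mulr1 ?mulr0 ?addr0 ?subr0 ?subrr ?sub0r ?opprK.
Qed.

Lemma Kmx_pos u a b : reflect (u 0 i2 = a / 2 * u 0 i1 /\ u 0 i3 = b / 2 * u 0 i1)
  (u <= eigenspace (Kmx a b) 1)%MS.
Proof.
have [k0 k1 k2 k3] := mul_Kmx u a b.
apply: (iffP eigenspaceP); rewrite scale1r; [move=> uK|move=> [u2 u3]].
  by rewrite uK in k2 k3; split; lra.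
by apply: row4P; rewrite ?k0 ?k1 ?k2 ?k3 //; lra.
Qed.

Lemma Kmx_neg u a b : reflect (u 0 i0 = 0 /\ u 0 i1 = 0)
  (u <= eigenspace (Kmx a b) (-1))%MS.
Proof.
have [k0 k1 k2 k3] := mul_Kmx u a b.
apply: (iffP eigenspaceP); rewrite scaleN1r; [move=> uK|move=> [u0 u1]].
  by rewrite uK !mxE in k0 k1; split; lra.
by apply: row4P; rewrite ?k0 ?k1 ?k2 ?k3 !mxE ?u0 ?u1 //; ring.
Qed.

Lemma rank_two_rows (E : M4) (B : 'M[R]_(2, 2 * 2)) (C : 'M[R]_(2 * 2, 2)) :
  B *m C = 1%:M -> (B <= E)%MS -> (forall u, (u <= E)%MS -> (u <= B)%MS) ->
  \rank E = 2.
Proof.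
move=> BC BE EB; have /eqP rB : row_free B by apply/row_freeP; exists C.
by rewrite -[RHS]rB; apply/eqP; rewrite eqn_leq !mxrankS//; apply/rV_subP.
Qed.

Lemma Kmx_rank_pos a b : \rank (eigenspace (Kmx a b) 1) = 2.
Proof.
pose B : 'M[R]_(2, 2 * 2) := \matrix_(i, j)
  nth 0 (nth [::] [:: [:: 1; 0; 0; 0]; [:: 0; 1; a / 2; b / 2]] i) j.
pose C : 'M[R]_(2 * 2, 2) := \matrix_(i, j) (val i == val j)%:R.
apply: (@rank_two_rows _ B C).
- by apply/matrixP => -[[|[|//]] ?] [[|[|//]] ?]; rewrite !mxE sum4 !mxE /=; ring.
- by apply/row_subP => -[[|[|//]] ?]; apply/Kmx_pos; rewrite !mxE /=; split; ring.
- move=> u /Kmx_pos[u2 u3].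
  have -> : u = (\row_j u 0 (widen_ord (isT : 2 <= 2 * 2)%N j)) *m B.
    have E0 : widen_ord (isT : 2 <= 2 * 2)%N ord0 = i0 by exact: val_inj.
    have E1 : widen_ord (isT : 2 <= 2 * 2)%N (lift ord0 ord0) = i1 by exact: val_inj.
    by apply: row4P; rewrite !mxE !big_ord_recl big_ord0 !mxE ?E0 ?E1 /=; lra.
  exact: submxMl.
Qed.

Lemma Kmx_rank_neg a b : \rank (eigenspace (Kmx a b) (-1)) = 2.
Proof.
pose B : 'M[R]_(2, 2 * 2) := \matrix_(i, j) ((val i).+2 == val j)%:R.
pose C : 'M[R]_(2 * 2, 2) := \matrix_(i, j) (val i == (val j).+2)%:R.
apply: (@rank_two_rows _ B C).
- by apply/matrixP => -[[|[|//]] ?] [[|[|//]] ?]; rewrite !mxE sum4 !mxE /=; ring.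
- by apply/row_subP => -[[|[|//]] ?]; apply/Kmx_neg; rewrite !mxE.
- move=> u /Kmx_neg[u0 u1].
  have -> : u = (\row_(j < 2) u 0 (if j == 0 then i2 else i3)) *m B.
    by apply: row4P; rewrite !mxE !big_ord_recl big_ord0 !mxE /= ?u0 ?u1; ring.
  exact: submxMl.
Qed.

End Example.

(** * The curve of D-complex structures on the 4-torus *)

Section Field.
Context {R : realType}.
Local Notation V := 'rV[R]_(2 * 2).
Local Notation M4 := 'M[R]_(2 * 2).
Local Notation T4 := (@torus_manifold R (2 * 2)).
Local Notation e k := (delta_mx 0 k : V).
Implicit Types (u v x y z : V) (t a b : R).

Definition wave (s : R) : R := sin (2 * pi * s).

Lemma wave_periodic s : wave (s + 1) = wave s.
Proof.
by rewrite /wave mulrDr mulr1 mulr_natl sinD2pi.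
Qed.

Lemma wave0 : wave 0 = 0.
Proof. by rewrite /wave mulr0 sin0. Qed.

Lemma is_derive_wave s : is_derive s (1:R) wave (2 * pi * cos (2 * pi * s)).
Proof.
rewrite mulrC; apply: (@is_derive1_comp R sin (fun s => 2 * pi * s)).
rewrite -[X in is_derive _ _ _ X]mulr1; exact: is_deriveZ.
Qed.

Definition lift_wave k (p : T4) : R := wave (sval (cid (tproj_surj p)) 0 k).

Lemma lift_waveE k x : lift_wave k (tproj x) = wave (x 0 k).
Proof.
rewrite /lift_wave; case: cid => y /= /tprojP/latticeP/(_ k).
rewrite !mxE => /intrP[m ym].
by rewrite -(periodic_int wave_periodic m (x 0 k)) -ym subrKC.
Qed.

(** The eigenbundle for [-1] is spanned by [d_2] and [d_3]; the one for [1] by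
    [d_0] and [d_1 + (t / 2) (wave x_2 d_2 - wave x_3 d_3)]. The perturbing
    field has a hyperbolic zero at [x_2 = x_3 = 0]. *)
Definition Kfield t (c : chart_ix T4) (p : T4) : M4 :=
  Kmx (t * lift_wave i2 p) (- (t * lift_wave i3 p)).

Definition Kper t x : M4 := Kmx (t * wave (x 0 i2)) (- (t * wave (x 0 i3))).

Lemma KfieldE t c : in_chart c (Kfield t c) = Kper t.
Proof. by apply/funext => x; rewrite /in_chart /= /Kfield !lift_waveE. Qed.

Lemma smooth_Kmx (W : normedModType R) (f g : W -> R) :
  smooth_on setT (f : W -> R^o) -> smooth_on setT (g : W -> R^o) ->
  smooth_on setT (fun w => Kmx (f w) (g w)).
Proof.
move=> sf sg k; apply: Ck_mx => i j.
rewrite (_ : (fun w => _) = (fun w =>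
  nth 0 (nth [::] [:: [:: 1; 0; 0; 0]; [:: 0; 1; f w; g w];
     [:: 0; 0; -1; 0]; [:: 0; 0; 0; -1]] i) j)); last by apply/funext => w; rewrite mxE.
by move: i j; apply: ord4_ind; apply: ord4_ind => /=;
  first [exact: sf|exact: sg|exact: smooth_cst].
Qed.

Lemma smooth_wave (W : normedModType R) (f : W -> R) :
  smooth_on setT (f : W -> R^o) -> smooth_on setT (wave \o f : W -> R^o).
Proof.
move=> sf k; suff H : Ck_on k setT (fun w => 2 * pi * f w : R^o) by case: (Ck_sin_cos H).
by apply: (@CkM _ _ _ (cst (2 * pi))); [exact: smooth_cst|exact: sf].
Qed.

Lemma smoothM (W : normedModType R) (f g : W -> R) :
  smooth_on setT (f : W -> R^o) -> smooth_on setT (g : W -> R^o) ->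
  smooth_on setT (fun w => f w * g w : R^o).
Proof. by move=> sf sg k; exact: CkM. Qed.

Lemma smoothN (W : normedModType R) (f : W -> R) :
  smooth_on setT (f : W -> R^o) -> smooth_on setT (fun w => - f w : R^o).
Proof.
move=> sf k; rewrite (_ : (fun w => - f w) = (cst (-1) : W -> R^o) \* f).
  by apply: CkM; [exact: smooth_cst|exact: sf].
by apply/funext => w /=; rewrite mulN1r.
Qed.

Lemma smooth_coord (i : 'I_(2 * 2)) : smooth_on setT (fun x : V => x 0 i : R^o).
Proof.
apply: smooth_additive => [x|h v x]; last by rewrite !mxE.
exact: (@differentiable_continuous R V R^o _ _ (@differentiable_coord R 1 _ x 0 i)).
Qed.

Lemma smooth_curve_coord (i : 'I_(2 * 2)) :
  smooth_on setT (fun tx : R * V => tx.2 0 i : R^o).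
Proof.
apply: smooth_additive => [x|h v x]; last by rewrite /= !mxE.
apply: (@continuous_comp _ _ _ snd (fun x : V => x 0 i)); first exact: cvg_snd.
exact: (@differentiable_continuous R V R^o _ _ (@differentiable_coord R 1 _ _ 0 i)).
Qed.

Lemma smooth_Kper t : smooth_on setT (Kper t).
Proof.
apply: smooth_Kmx; [|apply: smoothN]; apply: smoothM;
  by [exact: smooth_cst|apply: smooth_wave; exact: smooth_coord].
Qed.

Lemma smooth_curve_K (I : set R) : smooth_curve I Kfield.
Proof.
move=> c k; apply: (@Ck_onW _ _ _ _ setT) => //.
rewrite (_ : (fun tx => _) = (fun tx : R * V => Kper tx.1 tx.2)).
  apply: smooth_Kmx; [|apply: smoothN]; apply: smoothM;
    try (apply: smooth_wave; exact: smooth_curve_coord).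
    by apply: smooth_additive => // x; exact: cvg_fst.
  by apply: smooth_additive => // x; exact: cvg_fst.
by apply/funext => tx; rewrite -(KfieldE _ c).
Qed.

Lemma Kfield_almost t : @almost_dcomplex R 2 T4 (Kfield t).
Proof.
split; last first.
  by move=> c p _; split; [exact: Kmx_invol|exact: Kmx_rank_pos|exact: Kmx_rank_neg].
split=> [c k|c d p u cp dp].
  by rewrite KfieldE; apply: Ck_onW (smooth_Kper t k).
by rewrite !torus_trans_diff.
Qed.

Lemma derive_coord (f : V -> V) x v k : derivable f x v ->
  ('D_v f x) 0 k = 'D_v (fun y => f y 0 k) x.
Proof. by move=> fx; rewrite derive_mx// mxE. Qed.

(** Fields whose [k]-component is [g(x_k)] times their [l]-component are closed
    under bracket: the derivative of the coefficient contributes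
    [g' * (v_k w_l - w_k v_l)], which the same proportionality cancels. *)
Lemma bracket_graph (v w : V -> V) x k l (g : R -> R) dg :
  (forall u, derivable v x u) -> (forall u, derivable w x u) ->
  is_derive (x 0 k) (1:R) g dg ->
  (\forall y \near x, v y 0 k = g (y 0 k) * v y 0 l) ->
  (\forall y \near x, w y 0 k = g (y 0 k) * w y 0 l) ->
  ('D_(v x) w x - 'D_(w x) v x) 0 k =
  g (x 0 k) * ('D_(v x) w x - 'D_(w x) v x) 0 l.
Proof.
move=> dv dw gd vk wk.
have key (f : V -> V) u : (forall u, derivable f x u) ->
    (\forall y \near x, f y 0 k = g (y 0 k) * f y 0 l) ->
    ('D_u f x) 0 k = g (x 0 k) * ('D_u f x) 0 l + f x 0 l * (dg * u 0 k).
  move=> df fk; rewrite !derive_coord// (near_eq_derive u fk).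
  have cd : is_derive x u (fun y : V => y 0 k) (u 0 k).
    split; first by have [_ /(_ u)[+ _]] := smooth_coord k 1%N; apply.
    by rewrite -derive_coord ?derive_id.
  have fd : is_derive x u (fun y => f y 0 l) ('D_u (fun y => f y 0 l) x).
    by apply: derivableP; have /derivable_mxP := df u; apply.
  have gc := @is_derive_comp1 _ _ g (fun y : V => y 0 k) x u dg (u 0 k) gd cd.
  by case: (is_deriveM gc fd) => _ ->.
have vx := nbhs_singleton vk; have wx := nbhs_singleton wk.
have subE (A B : V) j : (A - B) 0 j = A 0 j - B 0 j by rewrite !mxE.
have kv := key v (w x) dv vk; have kw := key w (v x) dw wk.
rewrite !subE; move: kv kw vx wx.
by move: ('D_(w x) v x) ('D_(v x) w x) => A B -> -> -> ->; ring.
Qed.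

Lemma local_section t a (U : set T4) (v : chart_ix T4 -> T4 -> V)
    (c : chart_ix T4) p :
  open U -> eigen_section (Kfield t) a U v -> U p -> tdom c p ->
  let x := tchart c p in
  [/\ forall u, derivable (in_chart c (v c)) x u &
      \forall y \near x,
        (in_chart c (v c) y <= eigenspace (Kper t y) a)%MS].
Proof.
move=> oU [[sv _] ev] Up cp x; have [cx xp] := tchartP cp.
have Ox : (tchart c @` (U `&` tdom c)) x by exists p.
split=> [u|].
  by have [_ /(_ u)[+ _]] := sv c 1%N; apply.
have := open_nbhs_nbhs (conj (@tchart_image_open _ _ c U oU) Ox).
apply: (@filterS _ (nbhs x) _) => y; rewrite tchart_image => -[cy Uy].
by rewrite -(KfieldE t c); apply: ev => //; exists y.
Qed.

Lemma is_derive_half_wave t s : is_derive s (1:R) (fun s => t * wave s / 2)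
  (t * (2 * pi * cos (2 * pi * s)) / 2).
Proof.
have := @is_deriveZ _ _ _ wave (t / 2) s 1 _ (is_derive_wave s).
congr is_derive; last by rewrite /GRing.scale /=; ring.
by apply/funext => r; rewrite /GRing.scale /= mulrAC.
Qed.

Lemma Kfield_involutive_pos t : involutive_eigen (Kfield t) 1.
Proof.
move=> U v w oU ev ew c p Up cp.
have [dv Ev] := local_section oU ev Up cp.
have [dw Ew] := local_section oU ew Up cp.
have [cx xp] := tchartP cp.
rewrite -[X in Kfield t c X]xp.
have -> : Kfield t c (tproj (tchart c p)) = Kper t (tchart c p).
  by rewrite -(KfieldE t c).
rewrite /lie_bracket.
have -> : v c p = in_chart c (v c) (tchart c p) by rewrite /in_chart /= xp.
have -> : w c p = in_chart c (w c) (tchart c p) by rewrite /in_chart /= xp.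
apply/Kmx_pos; split.
- apply: (bracket_graph dv dw (is_derive_half_wave t _)).
  + by apply: filterS Ev => y /Kmx_pos[].
  + by apply: filterS Ew => y /Kmx_pos[].
- rewrite -[X in X / 2]mulNr; apply: (bracket_graph dv dw (is_derive_half_wave (- t) _)).
  + by apply: filterS Ev => y /Kmx_pos[_]; rewrite -mulNr.
  + by apply: filterS Ew => y /Kmx_pos[_]; rewrite -mulNr.
Qed.

Lemma Kfield_involutive_neg t : involutive_eigen (Kfield t) (-1).
Proof.
move=> U v w oU ev ew c p Up cp.
have [dv Ev] := local_section oU ev Up cp.
have [dw Ew] := local_section oU ew Up cp.
have [cx xp] := tchartP cp.
rewrite -[X in Kfield t c X]xp.
have -> : Kfield t c (tproj (tchart c p)) = Kper t (tchart c p).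
  by rewrite -(KfieldE t c).
rewrite /lie_bracket.
have -> : v c p = in_chart c (v c) (tchart c p) by rewrite /in_chart /= xp.
have -> : w c p = in_chart c (w c) (tchart c p) by rewrite /in_chart /= xp.
(* A vanishing component is the graph of the zero coefficient. *)
have E0 k (f : V -> V) : (\forall y \near tchart c p, f y 0 k = 0) ->
    \forall y \near tchart c p, f y 0 k = cst 0 (y 0 k) * f y 0 k.
  by apply: filterS => y ->; rewrite mulr0.
have bracket0 k := bracket_graph (k := k) (l := k) dv dw
  (is_derive_cst (0 : R) (tchart c p 0 k) 1).
apply/Kmx_neg; split.
- rewrite bracket0 ?mul0r//; apply: E0.
  + by apply: filterS Ev => y /Kmx_neg[].
  + by apply: filterS Ew => y /Kmx_neg[].
- rewrite bracket0 ?mul0r//; apply: E0.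
  + by apply: filterS Ev => y /Kmx_neg[].
  + by apply: filterS Ew => y /Kmx_neg[].
Qed.

Lemma Kfield_dcomplex t : @dcomplex R 2 T4 (Kfield t).
Proof.
split; [exact: Kfield_almost|exact: Kfield_involutive_pos
       |exact: Kfield_involutive_neg].
Qed.

End Field.

(** * D-Kaehler forms along a compact leaf *)

Section Form2.
Context {R : realType} {m : nat}.
Implicit Types (w : 'M[R]_m) (u v : 'rV[R]_m).

Lemma form2Dr w u v1 v2 : form2 w u (v1 + v2) = form2 w u v1 + form2 w u v2.
Proof. by rewrite /form2 linearD mulmxDr mxE. Qed.

Lemma form2Zr w u c v : form2 w u (c *: v) = c * form2 w u v.
Proof. by rewrite /form2 linearZ /= -scalemxAr mxE. Qed.

Lemma form2Dl w u1 u2 v : form2 w (u1 + u2) v = form2 w u1 v + form2 w u2 v.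
Proof. by rewrite /form2 !mulmxDl mxE. Qed.

Lemma form2Zl w c u v : form2 w (c *: u) v = c * form2 w u v.
Proof. by rewrite /form2 -!scalemxAl mxE. Qed.

Lemma form2_delta w i j : form2 w (delta_mx 0 i) (delta_mx 0 j) = w i j.
Proof. by rewrite /form2 -rowE trmx_delta -colE !mxE. Qed.

Lemma form2_alt w : (forall u, form2 w u u = 0) -> forall i j, w i j = - w j i.
Proof.
move=> alt i j; apply/eqP; rewrite -addr_eq0 -!form2_delta; apply/eqP.
have := alt (delta_mx 0 i + delta_mx 0 j).
by rewrite form2Dr !form2Dl !alt add0r addr0 addrC.
Qed.

End Form2.

Section Final.
Context {R : realType}.
Local Notation V := 'rV[R]_(2 * 2).
Local Notation M4 := 'M[R]_(2 * 2).
Local Notation T4 := (@torus_manifold R (2 * 2)).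
Local Notation e k := (delta_mx 0 k : V).
Implicit Types (u v x y z : V) (t a b : R).

Lemma Kfield0_dkahler : dkahler (@Kfield R 0).
Proof.
pose w : M4 := mx4 [:: [:: 0; 0; 1; 0]; [:: 0; 0; 0; 1];
                       [:: -1; 0; 0; 0]; [:: 0; -1; 0; 0]].
have wE u v : form2 w u v =
    u 0 i0 * v 0 i2 + u 0 i1 * v 0 i3 - u 0 i2 * v 0 i0 - u 0 i3 * v 0 i1.
  by rewrite /form2 !mxE sum4 !mxE !sum4 !mxE /=; ring.
(* The form dx_0 dx_2 + dx_1 dx_3, for which both coordinate planes are
   Lagrangian. *)
exists (fun _ _ => w); split; last first.
  move=> c p u v _; rewrite /Kfield !mul0r oppr0.
  have [k0 k1 k2 k3] := mul_Kmx u 0 0; have [l0 l1 l2 l3] := mul_Kmx v 0 0.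
  by rewrite !wE k0 k1 k2 k3 l0 l1 l2 l3; ring.
split.
- split=> [c k|c p u _|c d p u v cp dp].
  + by apply: (@Ck_onW _ _ _ _ setT) => //; exact: (@smooth_cst _ _ _ setT w).
  + by rewrite wE; ring.
  + by rewrite !torus_trans_diff.
- move=> c p u v z _; rewrite /ext_diff2.
  have D0 (r : R) u' : 'D_u' (in_chart c (fun=> r)) (chart c p) = 0.
    exact: (derive_cst r).
  by rewrite !D0; ring.
- move=> c p u _ u0; apply: row4P; rewrite !mxE.
  + by have := u0 (e i2); rewrite wE !mxE /= => <-; ring.
  + by have := u0 (e i3); rewrite wE !mxE /= => <-; ring.
  + by apply/eqP; rewrite -oppr_eq0; apply/eqP; have := u0 (e i0);
      rewrite wE !mxE /= => <-; ring.
  + by apply/eqP; rewrite -oppr_eq0; apply/eqP; have := u0 (e i1);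
      rewrite wE !mxE /= => <-; ring.
Qed.

(** On the torus the charts differ by translations, so the components of a form
    in the charts glue to one periodic matrix function on the universal cover. *)
Lemma dkahler_lift t : dkahler (@Kfield R t) -> exists W : V -> M4,
  [/\ smooth_on setT W,
      forall x k, k \in lattice -> W (x + k) = W x,
      forall x i j k, 'D_(e i) (fun y => W y j k) x - 'D_(e j) (fun y => W y i k) x
                      + 'D_(e k) (fun y => W y i j) x = 0,
      (forall x i j, W x i j = - W x j i) /\
      (forall x u, u *m W x = 0 -> u = 0) &
      forall x u v,
        form2 (W x) (u *m Kper t x) (v *m Kper t x) = - form2 (W x) u v].
Proof.
move=> [w [[[sw altw trw] dw ndw] Kw]].
have chart_indep c d p : tdom c p -> tdom d p -> w c p = w d p.
  move=> cp dp; apply/matrixP => i j; rewrite -!form2_delta.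
  by rewrite (trw c d p _ _ cp dp) !torus_trans_diff.
pose W x := w x (tproj x).
have loc c x : box c x -> w c (tproj x) = W x.
  by move=> cx; apply: chart_indep; [exists x|exact: tdom_center].
have near_loc x : \forall y \near x, w x (tproj y) = W y.
  have := open_nbhs_nbhs (conj (@box_open _ _ x) (@box_center _ _ x)).
  by apply: (@filterS _ (nbhs x) _) => y; exact: loc.
exists W; split.
- move=> k; apply: Ck_on_local => x _; exists (box x); first exact: box_center.
  apply: (@Ck_on_eq _ _ _ _ _ (w x \o tproj)); first exact: box_open.
    by move=> y /set_mem xy; exact: loc.
  by have := sw x k; rewrite setTI /= tchart_imageT.
- move=> x k kL; rewrite /W tprojD//; apply: chart_indep; last exact: tdom_center.
  by rewrite -(tprojD x kL); exact: tdom_center.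
- move=> x i j k.
  have := dw x (tproj x) (e i) (e j) (e k) (tdom_center x).
  rewrite /ext_diff2 /= (tchart_proj (box_center x)).
  have E (u v : V) l : 'D_(e l) (@in_chart _ _ T4 _ x (fun q => form2 (w x q) u v)) x =
      'D_(e l) (fun y => form2 (W y) u v) x.
    by apply: near_eq_derive; apply: filterS (near_loc x) => y; rewrite /in_chart /= => ->.
  have F i' j' : (fun y => form2 (W y) (e i') (e j')) = (fun y => W y i' j').
    by apply/funext => y; rewrite form2_delta.
  by rewrite !E !F.
- split=> [x i j|x u uW].
    by apply: form2_alt => u; apply: altw; exact: tdom_center.
  apply: ndw (tdom_center x) _ => v.
  by rewrite /form2 -/(W x) uW mul0mx mxE.
- move=> x u v; rewrite -(Kw x (tproj x) u v (tdom_center x)).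
  by rewrite -(KfieldE t x).
Qed.

(** The leaf [x_2 = x_3 = 0] of the foliation for [1]: the perturbing field
    vanishes on it. *)
Definition leaf (a b : R) : V := a *: e i0 + b *: e i1.

Lemma leaf_coord a b : leaf a b 0 i2 = 0 /\ leaf a b 0 i3 = 0.
Proof. by split; rewrite !mxE /= !mulr0 addr0. Qed.

Lemma leaf_continuous2 (g : V -> R) : continuous g ->
  continuous2 (fun a b => g (leaf a b)).
Proof.
move=> cg z; apply: (@continuous_comp _ _ _ (fun z : R * R => leaf z.1 z.2) g);
  last exact: cg.
have F : Filter (nbhs z) := nbhs_filter z.
exact: (@cvgD R V _ (nbhs z) F (fun w => w.1 *: e i0) (fun w => w.2 *: e i1) _ _
  (@cvgZr_tmp R V _ (nbhs z) F fst z.1 (e i0) cvg_fst)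
  (@cvgZr_tmp R V _ (nbhs z) F snd z.2 (e i1) cvg_snd)).
Qed.

Lemma is_derive_leaf_r (g : V -> R) a b : derivable g (leaf a b) (e i1) ->
  is_derive b (1:R) (fun b => g (leaf a b)) ('D_(e i1) g (leaf a b)).
Proof.
move=> /derivableP/is_deriveP gd; apply/is_deriveP.
suff E h : leaf a (h *: (1:R) + b) = h *: e i1 + leaf a b.
  by under eq_fun do rewrite E.
by rewrite /leaf (_ : h *: (1:R) = h) ?scalerDl 1?addrCA//; exact: mulr1.
Qed.

Lemma is_derive_leaf_l (g : V -> R) a b : derivable g (leaf a b) (e i0) ->
  is_derive a (1:R) (fun a => g (leaf a b)) ('D_(e i0) g (leaf a b)).
Proof.
move=> /derivableP/is_deriveP gd; apply/is_deriveP.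
suff E h : leaf (h *: (1:R) + a) b = h *: e i0 + leaf a b.
  by under eq_fun do rewrite E.
by rewrite /leaf (_ : h *: (1:R) = h) ?scalerDl ?addrA//; exact: mulr1.
Qed.

Lemma delta_lattice (k : 'I_(2 * 2)) : e k \in lattice.
Proof. by apply/latticeP => i; rewrite mxE natr_int. Qed.

Lemma leafDl a b : leaf (a + 1) b = leaf a b + e i0.
Proof. by rewrite /leaf scalerDl scale1r addrAC. Qed.

Lemma leafDr a b : leaf a (b + 1) = leaf a b + e i1.
Proof. by rewrite /leaf scalerDl scale1r addrA. Qed.

Lemma Kper_delta t x : let a := t * wave (x 0 i2) in let b := - (t * wave (x 0 i3)) in
  [/\ e i0 *m Kper t x = e i0, e i1 *m Kper t x = e i1 + a *: e i2 + b *: e i3,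
      e i2 *m Kper t x = - 1 *: e i2 & e i3 *m Kper t x = - 1 *: e i3].
Proof.
move=> a b; rewrite /Kper -/a -/b.
have K k := mul_Kmx (e k) a b.
by split; [have [] := K i0|have [] := K i1|have [] := K i2|have [] := K i3];
  move=> k0 k1 k2 k3; apply: row4P; rewrite ?k0 ?k1 ?k2 ?k3 !mxE /=; ring.
Qed.

(** Both eigenbundles are Lagrangian for a D-Kaehler form [W], so on the leaf
    only the entries with one index in [{0, 1}] and the other in [{2, 3}]
    survive. There closedness says that [W_0j dx + W_1j dy] is a twisted closed
    1-form with exponent [pi t] for [j = 2] and [- pi t] for [j = 3], and
    nondegeneracy says that the two forms are independent everywhere. *)
Lemma not_dkahler t : t != 0 -> ~ dkahler (@Kfield R t).
Proof.
move=> t0 /dkahler_lift[W [sW perW dW [altW ndW] KW]].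
pose A x : R := t * wave (x 0 i2); pose B x : R := - (t * wave (x 0 i3)).
have W23 x : W x i2 i3 = 0.
  have [_ _ K2 K3] := Kper_delta t x.
  have := KW x (e i2) (e i3); rewrite K2 K3 form2Zl form2Zr !form2_delta; lra.
have W01 x : W x i0 i1 = - 2^-1 * (A x * W x i0 i2 + B x * W x i0 i3).
  have [K0 K1 _ _] := Kper_delta t x.
  have := KW x (e i0) (e i1); rewrite K0 K1 !form2Dr !form2Zr !form2_delta.
  rewrite -/(A x) -/(B x); lra.
have Wd x i j k : derivable (fun y => W y i j) x (e k).
  by move: i j; apply/derivable_mxP; have [_ /(_ (e k))[+ _]] := sW 1%N; apply.
have Wc i j : continuous (fun x => W x i j).
  move=> x; apply: (@continuous_comp _ _ _ W (fun M : M4 => M i j)).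
    exact: (Ck_onS_continuous (sW 0%N)).
  exact: coord_continuous.
have Wdc i j k : continuous ('D_(e k) (fun y => W y i j)).
  have -> : 'D_(e k) (fun y => W y i j) = (fun y => 'D_(e k) W y i j).
    apply/funext => y; rewrite derive_mx ?mxE//.
    by have [_ /(_ (e k))[+ _]] := sW 1%N; apply.
  move=> x; apply: (@continuous_comp _ _ _ ('D_(e k) W) (fun M : M4 => M i j)).
    by have [_ /(_ (e k))[_ C]] := sW 1%N; apply: C; rewrite inE.
  exact: coord_continuous.
(* [W_01] is a combination of [W_0j] with coefficients vanishing on the leaf;
   their transverse derivatives provide the zeroth-order term [l p]. *)
have twist j l : (forall a b, 'D_(e j) (fun y => W y i0 i1) (leaf a b) =
       - l * W (leaf a b) i0 j) ->
    twisted_closed l (fun a b => W (leaf a b) i0 j) (fun a b => W (leaf a b) i1 j).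
  move=> Dj.
  exists (fun a b => 'D_(e i1) (fun y => W y i0 j) (leaf a b)),
         (fun a b => 'D_(e i0) (fun y => W y i1 j) (leaf a b)),
         (fun a b => 'D_(e i1) (fun y => W y i1 j) (leaf a b)).
  have lc g : continuous g -> continuous2 (fun a b => g (leaf a b)) :=
    @leaf_continuous2 g.
  split.
  - by split; [exact: (lc _ (Wc i0 j))|exact: (lc _ (Wc i1 j))
              |exact: (lc _ (Wdc i0 j i1))|exact: (lc _ (Wdc i1 j i1))].
  - split=> a b.
    + exact: (is_derive_leaf_r (Wd _ _ _ _)).
    + exact: (is_derive_leaf_l (Wd _ _ _ _)).
    + exact: (is_derive_leaf_r (Wd _ _ _ _)).
    + by have := dW (leaf a b) i0 i1 j; rewrite Dj; lra.
  - by split=> a b; rewrite ?leafDr ?leafDl perW// delta_lattice.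
  - by split=> a b; rewrite ?leafDr ?leafDl perW// delta_lattice.
have A0 a b : A (leaf a b) = 0.
  by rewrite /A (leaf_coord a b).1 wave0 mulr0.
have B0 a b : B (leaf a b) = 0.
  by rewrite /B (leaf_coord a b).2 wave0 mulr0 oppr0.
have dwave (i k : 'I_(2 * 2)) (c : R) a b : leaf a b 0 i = 0 ->
    is_derive (leaf a b) (e k) (fun x : V => c * wave (x 0 i)) (c * (2 * pi) * (i == k)%:R).
  move=> l0.
  have cd : is_derive (leaf a b) (e k) (fun y : V => y 0 i) (e k 0 i).
    split; first by have [_ /(_ (e k))[+ _]] := @smooth_coord R i 1%N; apply.
    by rewrite -(@derive_coord R id) ?derive_id.
  have wd := is_derive_wave (leaf a b 0 i).
  have := @is_deriveZ _ _ _ _ c _ _ _ (is_derive_comp1 wd cd).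
  congr is_derive.
  by rewrite /GRing.scale /= l0 !mulr0 cos0 mulr1 mxE eqxx !mulrA.
have DW01 a b k : 'D_(e k) (fun y => W y i0 i1) (leaf a b) =
    - (pi * t) * ((i2 == k)%:R * W (leaf a b) i0 i2 - (i3 == k)%:R * W (leaf a b) i0 i3).
  have [l2 l3] := leaf_coord a b.
  have dA := dwave i2 k t a b l2.
  have dB := dwave i3 k (- t) a b l3.
  have dW2 := derivableP (Wd (leaf a b) i0 i2 k).
  have dW3 := derivableP (Wd (leaf a b) i0 i3 k).
  have := @is_deriveZ _ _ _ _ (- 2^-1) _ _ _
    (is_deriveD (is_deriveM dA dW2) (is_deriveM dB dW3)).
  set f := (X in is_derive _ _ X _) => -[_ df].
  have -> : (fun y => W y i0 i1) = f.
    by apply/funext => y; rewrite W01 /f /A /B !fctE -[RHS]/(- 2^-1 * _); ring.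
  by rewrite df /GRing.scale /= l2 l3 wave0 !mulr0 !mul0r !add0r; field.
have pt0 : pi * t != 0 by rewrite mulf_neq0// gt_eqF// pi_gt0.
apply: (no_hyperbolic_coframe pt0 (twist i2 (pi * t) _) (twist i3 (- (pi * t)) _)).
- by move=> a b; rewrite DW01 /=; ring.
- by move=> a b; rewrite DW01 /=; ring.
move=> a b; apply/eqP => det0; set x := leaf a b in det0.
have W01x : W x i0 i1 = 0 by rewrite W01 A0 B0; ring.
have Wii i : W x i i = 0 by have := altW x i i; lra.
(* A relation between the rows 0 and 1 of [W x] gives a vector in its kernel,
   because the entries of these rows in columns 0 and 1 vanish. *)
have comb (c d : R) : c * W x i0 i2 + d * W x i1 i2 = 0 ->
    c * W x i0 i3 + d * W x i1 i3 = 0 -> c = 0 /\ d = 0.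
  move=> cd2 cd3; have u0 : c *: e i0 + d *: e i1 = 0.
    apply: (ndW x); rewrite mulmxDl -!scalemxAl -!rowE.
    apply: row4P; rewrite !mxE ?Wii ?(altW x i1 i0) ?W01x //; lra.
  by split; [move/rowP: u0 => /(_ i0)|move/rowP: u0 => /(_ i1)]; rewrite !mxE /=; lra.
have [||q2 p2] := comb (W x i1 i2) (- W x i0 i2).
- by ring.
- by rewrite -[RHS]oppr0 -det0; ring.
have [||q3 p3] := comb (W x i1 i3) (- W x i0 i3).
- by rewrite -[RHS]det0; ring.
- by ring.
have [||one _] := comb 1 0; [lra|lra|].
by have := oner_neq0 R; rewrite one eqxx.
Qed.

End Final.

Theorem theorem4p2 (R : realType) :
  exists (n : nat) (X : smooth_manifold R (2 * n)) (I : set R)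
         (K : R -> chart_ix X -> X -> 'M[R]_(2 * n)),
    [/\ compact [set: X],
        [/\ open I, is_interval I & I 0],
        smooth_curve I K,
        forall t, I t -> dcomplex (K t) &
        dkahler (K 0) /\ ~ (\forall t \near (0 : R), dkahler (K t))].
Proof.
exists 2, (torus_manifold (R := R)), setT, (@Kfield R); split.
- exact: torus_compact.
- by split => //; exact: openT.
- exact: smooth_curve_K.
- by move=> t _; exact: Kfield_dcomplex.
- split; first exact: Kfield0_dkahler.
  move=> near_dk; have [t t_dk t0] : exists2 t, dkahler (@Kfield R t) & t != 0.
    have [t []] := @filter_ex _ (0 : R)^' _ _ (filterI (nbhs_dnbhs near_dk)
      (nbhs_dnbhs_neq (0 : R))).
    by exists t.
  exact: not_dkahler t0 t_dk.
Qed.
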